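(* Let $F:(M,I,J,K,g_M)\to(N,g_N)$ be an almost h-semi-slant Riemannian map from a hyperkähler manifold to a Riemannian manifold such that $(I,J,K)$ is an almost h-semi-slant basis, with associated decompositions $\ker F_*=\mathcal{D}_1^R\oplus\mathcal{D}_2^R$, $R\in\{I,J,K\}$. Assume that $\widetilde{H}=0$, where $\widetilde{H}$ denotes the mean curvature vector field of $\mathrm{range}\,F_*$. Then each of the following conditions implies that $F$ is harmonic: a) $\mathcal{D}_1^I$ is integrable and $\mathrm{trace}(\nabla F_* )=0$ on $\mathcal{D}_2^I$; b) $\mathcal{D}_1^J$ is integrable and $\mathrm{trace}(\nabla F_* )=0$ on $\mathcal{D}_2^J$; c) $\mathcal{D}_1^K$ is integrable and $\mathrm{trace}(\nabla F_* )=0$ on $\mathcal{D}_2^K$.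
   Context: All manifolds and maps are $C^\infty$; $\Gamma(\cdot)$ denotes smooth sections. A hyperkähler manifold $(M,I,J,K,g_M)$ is a Riemannian manifold with globally defined endomorphism fields $I,J,K$ of $TM$, each parallel for the Levi-Civita connection $\nabla$ of $g_M$, satisfying $I^2=J^2=K^2=-\mathrm{id}$, $IJ=-JI=K$, $JK=-KJ=I$, $KI=-IK=J$, and $g_M(RX,RY)=g_M(X,Y)$ for $R\in\{I,J,K\}$. A map $F:(M,g_M)\to(N,g_N)$ is a Riemannian map if for every $p\in M$ the differential $(F_* )_p$ restricted to $(\ker (F_* )_p)^\perp$ is a linear isometry onto the image of $(F_* )_p$ (with metric induced from $g_N$). $F$ is an almost h-semi-slant Riemannian map with almost h-semi-slant basis $(I,J,K)$ if it is a Riemannian map and for each $R\in\{I,J,K\}$ there is a distribution $\mathcal{D}_1^R\subset\ker F_*$ with $R(\mathcal{D}_1^R)=\mathcal{D}_1^R$ such that, with $\mathcal{D}_2^R$ the orthogonal complement of $\mathcal{D}_1^R$ in $\ker F_*$, the angle $\theta_R$ between $RX$ and $(\mathcal{D}_2^R)_q$ is constant for all nonzero $X\in(\mathcal{D}_2^R)_q$ and all $q$. The second fundamental form of $F$ is $(\nabla F_* )(X,Y)=\nabla^F_XF_*Y-F_*(\nabla_XY)$, where $\nabla^F$ is the pullback connection on $F^{-1}TN$. $F$ is harmonic if $\mathrm{trace}(\nabla F_* )=0$ on $M$ (trace with respect to $g_M$). ''$\mathrm{trace}(\nabla F_* )=0$ on a distribution $\mathcal{D}$'' means $\sum_i(\nabla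 F_* )(e_i,e_i)=0$ for local orthonormal frames $\{e_i\}$ of $\mathcal{D}$. The bundle $F^{-1}TN$ decomposes orthogonally as $\mathrm{range}\,F_*\oplus(\mathrm{range}\,F_* )^\perp$; with $\bar{Q}$ the projection onto $(\mathrm{range}\,F_* )^\perp$, $l=\dim(\ker F_* )^\perp$ and $\{e_1,\dots,e_l\}$ a local orthonormal frame of $(\ker F_* )^\perp$, the mean curvature vector field of $\mathrm{range}\,F_*$ is $\widetilde{H}=\frac1l\sum_{i=1}^l\bar{Q}(\nabla^F_{e_i}F_*e_i)$. *)

(* Defs.v *)
From HB Require Import structures.
From mathcomp Require Import all_boot all_order all_algebra.
From mathcomp Require Import all_classical all_reals all_analysis.
From mathcomp Require Import ring.

Set Implicit Arguments.
Unset Strict Implicit.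
Unset Printing Implicit Defensive.

Import Order.TTheory GRing.Theory Num.Theory.
Import numFieldNormedType.Exports.

Local Open Scope classical_set_scope.
Local Open Scope ring_scope.

(* Vectors are row vectors: a linear map with matrix A sends v to v *m A, so
   the composite "A, then B" is A *m B.  Subspaces of R^n are row spaces. *)

(* [U] is meant to be open. *)
Fixpoint class_C (R : realType) (V W : normedModType R) (k : nat)
    (U : set V) (f : V -> W) : Prop :=
  match k with
  | 0 => forall x, U x -> {for x, continuous f}
  | k'.+1 => (forall x, U x -> differentiable f x) /\
             (forall v, class_C k' U (fun x => 'D_v f x))
  end.

Definition smooth_on (R : realType) (V W : normedModType R)
    (U : set V) (f : V -> W) : Prop := forall k, class_C k U f.

(* [cmap] restricts to a homeomorphism from the open set [cdom] onto an open
   subset of R^n, with inverse [cinv]; values elsewhere are irrelevant. *)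
Record chart (R : realType) (n : nat) (M : topologicalType) := Chart {
  cdom : set M ;
  cmap : M -> 'rV[R]_n ;
  cinv : 'rV[R]_n -> M ;
  cdom_open : open cdom ;
  cimg_open : open (cmap @` cdom) ;
  cmap_continuous : forall p, cdom p -> {for p, continuous cmap} ;
  cinv_continuous : forall u, (cmap @` cdom) u -> {for u, continuous cinv} ;
  cmapK : forall p, cdom p -> cinv (cmap p) = p
}.

(* A smooth manifold together with, at each point, a preferred chart around
   it.  The choice only serves to coordinatize the tangent spaces. *)
Record manifold (R : realType) (n : nat) := Manifold {
  carrier :> topologicalType ;
  carrier_hausdorff : hausdorff_space carrier ;
  carrier_second_countable : @second_countable carrier ;
  atlas : set (chart R n carrier) ;
  atlas_compatible : forall c d, atlas c -> atlas d ->
    smooth_on (cmap c @` (cdom c `&` cdom d)) (cmap d \o cinv c) ;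
  chart_at : carrier -> chart R n carrier ;
  chart_at_atlas : forall p, atlas (chart_at p) ;
  chart_at_dom : forall p, cdom (chart_at p) p
}.

(* T_pM is 'rV[R]_n: a tangent vector is given by its components in the
   preferred chart [chart_at p].  Vector fields are functions M -> 'rV[R]_n,
   and fields of bilinear forms or of endomorphisms are functions
   M -> 'M[R]_n, to be read in T_pM at each p. *)

Section Manifolds.
Variables (R : realType) (n : nat) (M : manifold R n).
Implicit Types (c : chart R n M) (p q : M) (U : set M) (g A D : M -> 'M[R]_n).

(* Differential at p of the chart c, from T_pM to R^n. *)
Definition to_chart c p : 'M[R]_n :=
  jacobian (cmap c \o cinv (chart_at p)) (cmap (chart_at p) p).

(* Its inverse; row i is the coordinate vector d/dx^i of c at p. *)
Definition of_chart c p : 'M[R]_n :=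
  jacobian (cmap (chart_at p) \o cinv c) (cmap c p).

Definition local_field c (X : M -> 'rV[R]_n) (u : 'rV[R]_n) : 'rV[R]_n :=
  X (cinv c u) *m to_chart c (cinv c u).

Definition local_metric c g (u : 'rV[R]_n) : 'M[R]_n :=
  of_chart c (cinv c u) *m g (cinv c u) *m (of_chart c (cinv c u))^T.

Definition local_endo c A (u : 'rV[R]_n) : 'M[R]_n :=
  of_chart c (cinv c u) *m A (cinv c u) *m to_chart c (cinv c u).

Definition smooth_field U (X : M -> 'rV[R]_n) : Prop :=
  forall c, atlas c -> smooth_on (cmap c @` (cdom c `&` U)) (local_field c X).

Definition smooth_endo A : Prop :=
  forall c, atlas c -> smooth_on (cmap c @` cdom c) (local_endo c A).

Definition frame_field k (E : M -> 'M[R]_(k, n)) (i : 'I_k) : M -> 'rV[R]_n :=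
  fun q => row i (E q).

Definition is_distribution D : Prop :=
  forall p, exists (U : set M) (k : nat) (E : M -> 'M[R]_(k, n)),
    [/\ open_nbhs p U,
        forall i, smooth_field U (frame_field E i) &
        forall q, U q -> row_free (E q) /\ (E q :=: D q)%MS].

(* Through every point passes an integral manifold of D, given by an immersion
   f of an open subset V of some R^k whose differentials have image D. *)
Definition integrable_distribution D : Prop :=
  forall p, exists (k : nat) (V : set 'rV[R]_k) (f : 'rV[R]_k -> M)
                   (v0 : 'rV[R]_k),
    [/\ open_nbhs v0 V, f v0 = p,
        forall v, V v -> {for v, continuous f},
        forall c, atlas c -> smooth_on (V `&` f @^-1` cdom c) (cmap c \o f) &
        forall v, V v ->
          let df := jacobian (cmap (chart_at (f v)) \o f) v in
          row_free df /\ (df :=: D (f v))%MS].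

End Manifolds.

Section EuclideanSpaces.
Variables (R : realType) (n : nat).
Implicit Types (g : 'M[R]_n) (v w : 'rV[R]_n).

Definition inner g v w : R := (v *m g *m w^T) 0 0.

(* Matrix whose row space is the g-orthogonal complement of that of A. *)
Definition orth k g (A : 'M[R]_(k, n)) : 'M[R]_n := kermx (g *m A^T).

Definition gnorm g v : R := Num.sqrt (inner g v v).

(* Angle between a nonzero vector w and the subspace D, that is, between w and
   its orthogonal projection to D; it lies in [0, pi/2]. *)
Definition angle g w (D : 'M[R]_n) : R :=
  acos (gnorm g (w *m proj_mx D (orth g D)) / gnorm g w).

(* Gamma(v, w)^k = v^i w^j Gamma^k_ij for the Christoffel symbols at u of the
   metric with coordinate matrix G, where
   Gamma^k_ij = 1/2 g^kl (d_i g_jl + d_j g_il - d_l g_ij). *)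
Definition christoffel (G : 'rV[R]_n -> 'M[R]_n) (u v w : 'rV[R]_n)
    : 'rV[R]_n :=
  (\row_l (2^-1 * (inner ('D_v G u) w 'e_l + inner ('D_w G u) v 'e_l
                   - inner ('D_'e_l G u) v w))) *m invmx (G u).

End EuclideanSpaces.

(* The next lemmas express that the connection with these symbols is torsion-free
   and metric; together they characterize the Levi-Civita connection. *)

Lemma innerC (R : realType) n (g : 'M[R]_n) (v w : 'rV[R]_n) :
  g^T = g -> inner g v w = inner g w v.
Proof.
move=> gT; rewrite /inner -[in RHS]gT.
have -> : w *m g^T *m v^T = (v *m g *m w^T)^T by rewrite !trmx_mul trmxK mulmxA.
by rewrite [RHS]mxE.
Qed.

Lemma trmx_derive (R : realType) n (G : 'rV[R]_n -> 'M[R]_n) (u t : 'rV[R]_n) :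
  (forall x, (G x)^T = G x) -> differentiable G u -> ('D_t G u)^T = 'D_t G u.
Proof.
move=> GT dG; rewrite derive_mx; last exact: diff_derivable.
apply/matrixP => i j; rewrite !mxE; congr ('D_t _ u).
by apply/funext => x; rewrite -[in LHS]GT mxE.
Qed.

Lemma christoffelC (R : realType) n (G : 'rV[R]_n -> 'M[R]_n)
    (u v w : 'rV[R]_n) :
  (forall x, (G x)^T = G x) -> differentiable G u ->
  christoffel G u v w = christoffel G u w v.
Proof.
move=> GT dG; rewrite /christoffel; congr (_ *m _).
have := fun t => trmx_derive t GT dG; move: (derive G u) => dGu DT.
apply/rowP => l; rewrite [LHS]mxE [RHS]mxE (innerC w v (DT _)).
by rewrite (addrC (inner (dGu w) v _)).
Qed.

Lemma christoffel_metric (R : realType) n (G : 'rV[R]_n -> 'M[R]_n)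
    (u v w z : 'rV[R]_n) :
  (forall x, (G x)^T = G x) -> differentiable G u -> G u \in unitmx ->
  inner ('D_v G u) w z
  = inner (G u) (christoffel G u v w) z + inner (G u) w (christoffel G u v z).
Proof.
move=> GT dG uG; rewrite [inner _ w (christoffel _ _ _ _)]innerC//.
have Dsum c : 'D_c G u = \sum_l c 0 l *: 'D_'e_l G u.
  rewrite (deriveE _ dG) [c in 'd G u c]row_sum_delta linear_sum.
  by apply: eq_bigr => l _; rewrite linearZ/= (deriveE _ dG).
have := fun t => trmx_derive t GT dG.
rewrite /christoffel; move: (derive G u) Dsum => dGu Dsum DT.
have lin (a b c : 'rV[R]_n) :
    inner (G u) ((\row_l (2^-1 * (inner (dGu a) b 'e_l + inner (dGu b) a 'e_l
                   - inner (dGu 'e_l) a b))) *m invmx (G u)) c =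
    2^-1 * (inner (dGu a) b c + inner (dGu b) a c - inner (dGu c) a b).
  rewrite {1}/inner mulmxKV// mxE.
  have rE (A : 'M[R]_n) x y : inner A x y = \sum_l y 0 l * inner A x 'e_l.
    rewrite {1}/inner {1}[y]row_sum_delta linear_sum mulmx_sumr summxE.
    by apply: eq_bigr => l _; rewrite linearZ/= -scalemxAr mxE.
  have dE : inner (dGu c) a b = \sum_l c 0 l * inner (dGu 'e_l) a b.
    rewrite {1}/inner Dsum mulmx_sumr mulmx_suml summxE.
    by apply: eq_bigr => l _; rewrite -scalemxAr -scalemxAl mxE.
  rewrite (rE _ b c) (rE _ a c) dE -big_split/= -sumrB mulr_sumr.
  apply: eq_bigr => l _; rewrite [X in X * _ = _]mxE [c^T l 0]mxE.
  by ring.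
by rewrite !lin [inner (dGu v) z w]innerC//; field.
Qed.

(* Hence tangent vectors at p are their own components in [chart_at p]. *)
Lemma to_chart_id (R : realType) n (M : manifold R n) (p : M) :
  to_chart (chart_at p) p = 1%:M.
Proof.
have pd := chart_at_dom p.
set c := chart_at p; pose u := cmap c p.
have uI : (cmap c @` (cdom c `&` cdom c)) u by exists p.
have df : differentiable (cmap c \o cinv c) u.
  have /(_ 1%N)[+ _] := atlas_compatible (chart_at_atlas p) (chart_at_atlas p).
  exact.
apply/row_matrixP => i; rewrite !rowE -deriveEjacobian// mulmx1.
rewrite -[RHS](@derive_id _ 'rV[R]_n u); apply: near_eq_derive.
have : nbhs u (cmap c @` cdom c).
  by apply: open_nbhs_nbhs; split; [exact: cimg_open|exists p].
by apply: filterS => _ [q qc <-] /=; rewrite cmapK.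
Qed.

Section Riemannian.
Variables (R : realType) (n : nat) (M : manifold R n).
Implicit Types (p q : M) (U : set M) (g A D : M -> 'M[R]_n).

Definition riemannian_metric g : Prop :=
  [/\ forall p, (g p)^T = g p,
      forall p v, v != 0 -> 0 < inner (g p) v v &
      forall c, atlas c -> smooth_on (cmap c @` cdom c) (local_metric c g)].

(* (nabla_v Y)(p) for the Levi-Civita connection of g, v in T_pM and Y a vector
   field near p, in the coordinates of [chart_at p]. *)
Definition levi_civita g p (v : 'rV[R]_n) (Y : M -> 'rV[R]_n) : 'rV[R]_n :=
  let c := chart_at p in
  'D_v (local_field c Y) (cmap c p)
  + christoffel (local_metric c g) (cmap c p) v (Y p).

Definition parallel g A : Prop :=
  forall p U (Y : M -> 'rV[R]_n) (v : 'rV[R]_n),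
    open_nbhs p U -> smooth_field U Y ->
    levi_civita g p v (fun q => Y q *m A q) = levi_civita g p v Y *m A p.

(* In terms of operators, I J = K reads J p *m I p = K p, and so on. *)
Definition hyperkahler g (I J K : M -> 'M[R]_n) : Prop :=
  [/\ riemannian_metric g,
      (forall A, A = I \/ A = J \/ A = K ->
        [/\ smooth_endo A, parallel g A,
            forall p, A p *m A p = - 1%:M &
            forall p v w, inner (g p) (v *m A p) (w *m A p) = inner (g p) v w]),
      (forall p, J p *m I p = K p /\ I p *m J p = - K p),
      (forall p, K p *m J p = I p /\ J p *m K p = - I p) &
      (forall p, I p *m K p = J p /\ K p *m I p = - J p)].

Definition orthonormal_frame g U D k (E : M -> 'M[R]_(k, n)) : Prop :=
  (forall i, smooth_field U (frame_field E i)) /\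
  (forall q, U q -> E q *m g q *m (E q)^T = 1%:M /\ (E q :=: D q)%MS).

End Riemannian.

Section Maps.
Variables (R : realType) (n m : nat) (M : manifold R n) (N : manifold R m).
Variables (gM : M -> 'M[R]_n) (gN : N -> 'M[R]_m) (F : M -> N).
Implicit Types (p q : M) (U : set M) (D : M -> 'M[R]_n).

Definition smooth_map : Prop :=
  continuous F /\
  forall c d, atlas c -> atlas d ->
    smooth_on (cmap c @` (cdom c `&` F @^-1` cdom d)) (cmap d \o F \o cinv c).

Definition differential p : 'M[R]_(n, m) :=
  jacobian (cmap (chart_at (F p)) \o F \o cinv (chart_at p))
           (cmap (chart_at p) p).

Definition ker_diff p : 'M[R]_n := kermx (differential p).

Definition horizontal p : 'M[R]_n := orth (gM p) (ker_diff p).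

Definition range_diff p : 'M[R]_m := <<differential p>>%MS.

Definition riemannian_map : Prop :=
  smooth_map /\
  forall p v w, (v <= horizontal p)%MS -> (w <= horizontal p)%MS ->
    inner (gN (F p)) (v *m differential p) (w *m differential p)
    = inner (gM p) v w.

(* D_2 from D_1 : the orthogonal complement of D_1 in ker dF. *)
Definition ker_complement D p : 'M[R]_n :=
  (ker_diff p :&: orth (gM p) (D p))%MS.

Definition semi_slant_distribution (A D : M -> 'M[R]_n) : Prop :=
  [/\ is_distribution D,
      forall p, (D p <= ker_diff p)%MS,
      forall p, (D p *m A p :=: D p)%MS &
      exists theta : R, forall q v,
        (v <= ker_complement D q)%MS -> v != 0 ->
        angle (gM q) (v *m A q) (ker_complement D q) = theta].

(* DI, DJ and DK are the distributions D_1 for I, J and K. *)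
Definition almost_h_semi_slant (I J K DI DJ DK : M -> 'M[R]_n) : Prop :=
  [/\ riemannian_map, semi_slant_distribution I DI,
      semi_slant_distribution J DJ & semi_slant_distribution K DK].

(* (nabla^F_v V)(p) for the pullback of the Levi-Civita connection of N, where
   V is a section of F^{-1}TN, i.e. V q is a vector of T_{F q}N. *)
Definition pullback_connection p (v : 'rV[R]_n) (V : M -> 'rV[R]_m)
    : 'rV[R]_m :=
  let c := chart_at p in
  let d := chart_at (F p) in
  'D_v (fun u => V (cinv c u) *m to_chart d (F (cinv c u))) (cmap c p)
  + christoffel (local_metric d gN) (cmap d (F p))
                (v *m differential p) (V p).

Definition pushforward (X : M -> 'rV[R]_n) : M -> 'rV[R]_m :=
  fun q => X q *m differential q.

Definition second_fundamental_form (X Y : M -> 'rV[R]_n) p : 'rV[R]_m :=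
  pullback_connection p (X p) (pushforward Y)
  - levi_civita gM p (X p) Y *m differential p.

Definition trace_zero_on D : Prop :=
  forall p U k (E : M -> 'M[R]_(k, n)),
    open_nbhs p U -> orthonormal_frame gM U D E ->
    \sum_(i < k) second_fundamental_form (frame_field E i) (frame_field E i) p
    = 0.

Definition harmonic_map : Prop := trace_zero_on (fun _ => 1%:M).

(* Projection of T_{F p}N onto the orthogonal complement of range dF along
   range dF. *)
Definition normal_proj p : 'M[R]_m :=
  proj_mx (orth (gN (F p)) (range_diff p)) (range_diff p).

(* Computed with the orthonormal frame E of the orthogonal complement of
   ker dF. *)
Definition mean_curvature l (E : M -> 'M[R]_(l, n)) p : 'rV[R]_m :=
  l%:R^-1 *: \sum_(i < l)
    pullback_connection p (frame_field E i p) (pushforward (frame_field E i))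
      *m normal_proj p.

Definition mean_curvature_zero : Prop :=
  forall p U l (E : M -> 'M[R]_(l, n)),
    open_nbhs p U -> orthonormal_frame gM U horizontal E ->
    mean_curvature E p = 0.

End Maps.

(* Main.v *)
Require Import Defs.
From HB Require Import structures.
From mathcomp Require Import all_boot all_order all_algebra.
From mathcomp Require Import all_classical all_reals all_analysis.
From mathcomp Require Import perm ring lra.

Set Implicit Arguments.
Unset Strict Implicit.
Unset Printing Implicit Defensive.

Import Order.TTheory GRing.Theory Num.Theory.
Import numFieldNormedType.Exports.

Local Open Scope classical_set_scope.
Local Open Scope ring_scope.

(** Let A be one of the three complex structures, D_1 the corresponding
    A-invariant distribution and D_2 its complement in ker dF.  At each point the
    tangent space is the orthogonal sum of the horizontal space, D_1 and D_2, and
    the trace of the second fundamental form B = nabla dF vanishes on each summand.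

    - On the horizontal space, gN (B (X, Y), dF Z) is symmetric in X, Y because
      the connections are torsion-free, [hessianC].  Differentiating the isometry
      relation gN (dF Y, dF Z) = gM (Y, Z) shows that it is also skew in Y, Z,
      [hessian_skew].  A trilinear form with both symmetries is zero, so B (X, Y)
      is normal to range dF, and the trace of the normal part of nabla dF over
      horizontal vectors is a multiple of the mean curvature vector, which
      vanishes, [horizontal_trace].

    - On D_1, B (X, Y) = - dF (nabla_X Y).  As A is parallel with A^2 = -1, and the
      bracket of the sections X and A X of D_1 stays in D_1 by integrability,
      [integrable_bracket], one finds B (A X, A X) = - B (X, X), [hessian_complex].
      But A is an isometry of D_1 and maps orthonormal bases to orthonormal bases,
      so the trace over D_1 equals its opposite.

    - On D_2 the trace vanishes by assumption.

    The conditions on D_2 and on the mean curvature speak of smooth local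
    orthonormal frames, and such frames have to be produced.  In an orthonormal
    frame of TM, the orthogonal projection onto the horizontal space is dF followed
    by its adjoint, because dF is isometric on that space,
    [horizontal_projection]; it is therefore smooth, and its rank is locally
    constant.  So are the projection onto D_1, which has local frames, and the
    projection onto D_2, which is the difference.  A smooth field of orthogonal
    projections has local orthonormal frames, by a Gram-Schmidt process that peels
    off one unit vector at a time, [smooth_projection_frame].  Traces over a
    subspace are traces against its projection, [trace_quadratic], and the three
    projections add up to the identity.

    The symmetry of second derivatives, [derive_jacobianC], is the analytic fact
    behind both the symmetry of B and the computation of brackets on integral
    manifolds. *)

(** * Functions of class C^k *)

Section SmoothFunctions.
Variables (R : realType) (V : normedModType R).
Implicit Types (U : set V).

(** The difference of f and g vanishes near x, so it is differentiable at x
    with differential zero. *)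
Lemma near_eq_diff (W : normedModType R) (f g : V -> W) x :
  {near x, f =1 g} -> differentiable f x -> differentiable g x.
Proof.
move=> fg df.
have fx : f x = g x by exact: (nbhs_singleton fg).
pose h := g - f.
have hz : \forall z \near 0, h (z + x) = 0.
  have := fg; rewrite (near_shift 0)/=; apply: filterS => z /=.
  by rewrite subr0 /h !fctE => ->; rewrite subrr.
have dh : differentiable h x.
  pose z0 := 'd (cst (0 : W) : V -> W) x.
  have z0E y : z0 y = 0 by rewrite /z0 diff_cst.
  have E : h \o shift x = cst (h x) + z0 +o_ 0 id.
    apply/eqaddoP => _/posnumP[e]; near=> z.
    rewrite /= !fctE/= (_ : h (z + x) = 0); last by near: z.
    by rewrite /h !fctE fx subrr z0E addr0 subr0 normr0 mulr_ge0.
  have c0 : continuous z0.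
    have -> : (z0 : V -> W) = cst 0 by apply/funext => y; rewrite z0E.
    exact: cst_continuous.
  have D := diff_unique c0 E.
  by apply/diff_locallyP; split; rewrite D.
have -> : g = f + h by rewrite /h addrC subrK.
exact: differentiableD.
Unshelve. all: by end_near. Qed.

Lemma near_eq_continuous (W : topologicalType) (f g : V -> W) x :
  {near x, f =1 g} -> {for x, continuous f} -> {for x, continuous g}.
Proof.
move=> fg cf; rewrite /prop_for /continuous_at -(nbhs_singleton fg).
by apply: cvg_trans cf; apply: near_eq_cvg; exact: fg.
Qed.

Lemma open_near_eq (W : Type) U (f g : V -> W) x : open U -> U x ->
  (forall y, U y -> f y = g y) -> {near x, f =1 g}.
Proof.
by move=> oU Ux fg; apply: filterS (open_nbhs_nbhs (conj oU Ux)) => y /fg.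
Qed.

(** Derivatives at a point depend on the germ there, and since U is open,
    f and g have the same germ at each point of U. *)
Lemma class_C_eq (W : normedModType R) k U (f g : V -> W) : open U ->
  (forall x, U x -> f x = g x) -> class_C k U f -> class_C k U g.
Proof.
move=> oU; elim: k f g => [|k IH] f g fg /=.
  by move=> cf x Ux; apply: (near_eq_continuous (open_near_eq oU Ux fg)); exact: cf.
move=> [df Df]; split=> [x Ux|v].
  by apply: (near_eq_diff (open_near_eq oU Ux fg)); exact: df.
apply: IH (Df v) => x Ux; apply: near_eq_derive; exact: open_near_eq oU Ux fg.
Qed.

Lemma class_C_le (W : normedModType R) k U U' (f : V -> W) :
  U' `<=` U -> class_C k U f -> class_C k U' f.
Proof.
move=> UU; elim: k f => [|k IH] f /=; first by move=> cf x /UU/cf.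
by move=> [df Df]; split=> [x /UU/df//|v]; exact: IH.
Qed.

Lemma class_C_local (W : normedModType R) k U (f : V -> W) :
  (forall x, U x -> exists2 U', U' x & class_C k U' f) -> class_C k U f.
Proof.
elim: k f => [|k IH] f H /=; first by move=> x /H[U' U'x]; apply.
split=> [x /H[U' U'x /= [df _]]|v]; first exact: df.
by apply: IH => x /H[U' U'x /= [_ Df]]; exists U'.
Qed.

Lemma class_CW (W : normedModType R) k U (f : V -> W) :
  class_C k.+1 U f -> class_C k U f.
Proof.
elim: k f => [|k IH] f [df Df].
  by move=> x Ux; exact: differentiable_continuous (df x Ux).
by split=> // v; exact: IH.
Qed.

Lemma class_C_cst (W : normedModType R) k U (a : W) : class_C k U (fun=> a).
Proof.
elim: k a => [|k IH] a /=; first by move=> x _; exact: cst_continuous.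
split=> [x _|v]; first exact: differentiable_cst.
have -> : (fun x : V => 'D_v (fun=> a) x) = (fun=> 0) by apply/funext => x; rewrite derive_cst.
exact: IH.
Qed.

Lemma class_CD (W : normedModType R) k U (f g : V -> W) : open U ->
  class_C k U f -> class_C k U g -> class_C k U (fun x => f x + g x).
Proof.
move=> oU; elim: k f g => [|k IH] f g /=.
  by move=> cf cg x Ux; apply: (@continuousD _ _ _ f g x); [exact: cf|exact: cg].
move=> [df Df] [dg Dg]; split=> [x Ux|v].
  by apply: (@differentiableD _ _ _ f g x); [exact: df|exact: dg].
apply: class_C_eq (IH _ _ (Df v) (Dg v)) => // x Ux; apply/esym.
by apply: (@deriveD _ _ _ f g); apply: diff_derivable; [exact: df|exact: dg].
Qed.

(** By Leibniz' rule the directional derivatives of a product are sums of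
    products, which is what makes an induction on k work.  The closure under
    inverses, inverse square roots and composition has the same structure. *)
Lemma class_CM k U (f g : V -> R) : open U ->
  class_C k U f -> class_C k U g -> class_C k U (fun x => f x * g x).
Proof.
move=> oU; elim: k f g => [|k IH] f g.
  by move=> cf cg x Ux; apply: (@continuousM _ _ f g x); [exact: cf|exact: cg].
move=> Cf Cg; have [df Df] := Cf; have [dg Dg] := Cg; split=> [x Ux|v].
  by apply: (@differentiableM _ _ f g x); [exact: df|exact: dg].
have H := class_CD oU (IH _ _ (class_CW Cf) (Dg v)) (IH _ _ (class_CW Cg) (Df v)).
apply: class_C_eq H => // x Ux; apply/esym.
by apply: (@deriveM _ _ f g); apply: diff_derivable; [exact: df|exact: dg].
Qed.

Lemma class_C_sum (W : normedModType R) k U (I : Type) (r : seq I) (P : pred I)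
    (f : I -> V -> W) : open U ->
  (forall i, P i -> class_C k U (f i)) ->
  class_C k U (fun x => \sum_(i <- r | P i) f i x).
Proof.
move=> oU Cf; elim: r => [|i r IH].
  by under eq_fun do rewrite big_nil; exact: class_C_cst.
have [Pi|/negbTE nPi] := boolP (P i).
  by under eq_fun do rewrite big_cons Pi; exact: class_CD (Cf i Pi) IH.
by under eq_fun do rewrite big_cons nPi.
Qed.

Lemma class_C_prod k U (I : Type) (r : seq I) (P : pred I) (f : I -> V -> R) :
  open U -> (forall i, P i -> class_C k U (f i)) ->
  class_C k U (fun x => \prod_(i <- r | P i) f i x).
Proof.
move=> oU Cf; elim: r => [|i r IH].
  by under eq_fun do rewrite big_nil; exact: class_C_cst.
have [Pi|/negbTE nPi] := boolP (P i).
  by under eq_fun do rewrite big_cons Pi; exact: class_CM (Cf i Pi) IH.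
by under eq_fun do rewrite big_cons nPi.
Qed.

Lemma class_CV k U (f : V -> R) : open U -> (forall x, U x -> f x != 0) ->
  class_C k U f -> class_C k U (fun x => (f x)^-1).
Proof.
move=> oU f0; elim: k => [|k IH].
  by move=> cf x Ux; apply: (@continuousV _ _ f x); [exact: f0|exact: cf].
move=> Cf; have [df Df] := Cf; split=> [x Ux|v].
  by apply: (@differentiableV _ _ f x); [exact: df|exact: f0].
have I := IH (class_CW Cf).
have H := class_CM oU (class_CM oU (class_C_cst (W := R) k U (-1)) (class_CM oU I I)) (Df v).
apply: class_C_eq H => // x Ux; rewrite deriveV ?f0 -?exprVn ?expr2 ?mulN1r//.
exact/diff_derivable/df.
Qed.

Lemma diff_invsqrt (f : V -> R) x : 0 < f x -> differentiable f x ->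
  differentiable (fun y => (Num.sqrt (f y))^-1) x /\
  forall v, 'D_v (fun y => (Num.sqrt (f y))^-1) x
    = - 2^-1 * (Num.sqrt (f x))^-1 ^+ 3 * 'D_v f x.
Proof.
move=> f0 df.
have ds : differentiable (@Num.sqrt R) (f x).
  by apply/derivable1_diffP; have [] := is_derive1_sqrt f0.
have dsf : differentiable (Num.sqrt \o f) x by exact: differentiable_comp.
have s0 : (Num.sqrt \o f) x != 0 by rewrite /= sqrtr_eq0 -ltNge.
split=> [|v]; first exact: (@differentiableV _ _ (Num.sqrt \o f)).
rewrite (@deriveV _ _ (Num.sqrt \o f))//; last exact: diff_derivable.
rewrite (deriveE _ dsf) diff_comp//= (diff1E ds)/=.
rewrite -deriveE// derive1E derive_sqrt//.
rewrite -[LHS]/(- (Num.sqrt (f x)) ^- 2 * ('D_v f x * (2 * Num.sqrt (f x))^-1)).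
by rewrite -exprVn invfM; ring.
Qed.

(** The derivative of f^(-1/2) is a multiple of its cube times the derivative
    of f.  Inverse square roots normalize the vectors of a frame. *)
Lemma class_C_invsqrt k U (f : V -> R) : open U -> (forall x, U x -> 0 < f x) ->
  class_C k U f -> class_C k U (fun x => (Num.sqrt (f x))^-1).
Proof.
move=> oU f0; elim: k => [|k IH].
  move=> cf x Ux; apply: (@continuousV _ _ (Num.sqrt \o f) x).
    by rewrite /= sqrtr_eq0 -ltNge f0.
  by apply: continuous_comp; [exact: cf|exact: sqrt_continuous].
move=> Cf; have [df Df] := Cf; split=> [x Ux|v].
  by have [] := diff_invsqrt (f0 x Ux) (df x Ux).
have I := IH (class_CW Cf).
have H := class_CM oU (class_CM oU (class_C_cst (W := R) k U (- 2^-1))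
  (class_CM oU I (class_CM oU I I))) (Df v).
apply: class_C_eq H => // x Ux.
by have [_ ->] := diff_invsqrt (f0 x Ux) (df x Ux); rewrite !exprS expr0 mulr1.
Qed.

Lemma diff_mxP n m (f : V -> 'M[R]_(n, m)) x :
  differentiable f x <-> forall i j, differentiable (fun y => f y i j) x.
Proof.
split=> [df i j|df].
  have -> : (fun y => f y i j) = (fun N : 'M[R]_(n, m) => N i j : R) \o f by [].
  exact/differentiable_comp/differentiable_coord.
have -> : f = \sum_i \sum_j (fun y => f y i j *: (delta_mx i j : 'M[R]_(n, m))).
  apply/funext => y; rewrite [LHS]matrix_sum_delta fct_sumE; apply: eq_bigr => i _.
  by rewrite fct_sumE.
apply: differentiable_sum => i; apply: differentiable_sum => j.
exact: differentiableZl.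
Qed.

Lemma derive_entry n m (f : V -> 'M[R]_(n, m)) x v i j : differentiable f x ->
  'D_v f x i j = 'D_v (fun y => f y i j) x.
Proof. by move=> df; rewrite derive_mx ?mxE//; exact: diff_derivable. Qed.

Lemma class_C_mxP n m k U (f : V -> 'M[R]_(n, m)) : open U ->
  class_C k U f <-> forall i j, class_C k U (fun y => f y i j).
Proof.
move=> oU; elim: k f => [|k IH] f /=; split.
- move=> cf i j x Ux; have -> : (fun y => f y i j) = (fun N : 'M[R]_(n, m) => N i j : R) \o f by [].
  by apply: continuous_comp; [exact: cf|exact: coord_continuous].
- move=> cf; have -> : f = fun y => \sum_i \sum_j (f y i j *: (delta_mx i j : 'M[R]_(n, m))).
    by apply/funext => y; rewrite [LHS]matrix_sum_delta.
  apply: (@class_C_sum _ 0) => // i _; apply: (@class_C_sum _ 0) => // j _ x Ux.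
  by apply: cvgZr_tmp; exact: cf.
- move=> [df Df] i j; split=> [x Ux|v]; first by have /diff_mxP := df x Ux; apply.
  have /IH/(_ i j) := Df v; apply: class_C_eq => // x Ux.
  by rewrite derive_entry//; exact: df.
- move=> H; have df x : U x -> differentiable f x.
    by move=> Ux; apply/diff_mxP => i j; have [+ _] := H i j; apply.
  split=> // v; apply/IH => i j; have [_ /(_ v)] := H i j.
  by apply: class_C_eq => // x Ux; rewrite derive_entry//; exact: df.
Qed.

Lemma class_C_mulmx n m l k U (f : V -> 'M[R]_(n, m)) (g : V -> 'M[R]_(m, l)) :
  open U -> class_C k U f -> class_C k U g ->
  class_C k U (fun x => f x *m g x).
Proof.
move=> oU /(class_C_mxP _ _ oU) Cf /(class_C_mxP _ _ oU) Cg.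
apply/class_C_mxP => // i j; under eq_fun do rewrite mxE.
by apply: class_C_sum => // a _; exact: class_CM.
Qed.

End SmoothFunctions.

(** * Symmetry of second derivatives *)

Section SymmetryOfSecondDerivatives.
Variables (R : realType) (V : normedModType R).
Implicit Types (U : set V).

Lemma is_derive_line (W : normedModType R) (f : V -> W) (v a : V) (t : R) :
  differentiable f (t *: v + a) ->
  is_derive t 1 (fun s : R => f (s *: v + a)) ('D_v f (t *: v + a)).
Proof.
move=> df; pose l := (fun s : R => s *: v + a).
have dl : is_diff t l (fun s : R => s *: v).
  have H : is_diff t (( *:%R ^~ v : R -> V) + cst a) (( *:%R ^~ v : R -> V) + 0).
    by apply: is_diffD.
  by rewrite addr0 in H; exact: H.
have [dl1 dlE] := dl.
have dfl : differentiable (f \o l) t by exact: differentiable_comp.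
apply: DeriveDef; first exact: (@diff_derivable _ _ _ (f \o l)).
by rewrite (deriveE _ dfl) diff_comp//= (deriveE _ df) dlE scale1r.
Qed.

(** The second difference is the increment over [0, h] of the function
    t |-> f (t v + h w + x) - f (t v + x).  By the mean value theorem it is h
    times a difference of two values of D_v f at points within O(h) of x, and
    differentiability of D_v f at x estimates that difference. *)
Lemma second_difference U (f : V -> R) (x v w : V) (e : R) : open U -> U x ->
  (forall y, U y -> differentiable f y) -> differentiable ('D_v f) x -> 0 < e ->
  \forall h \near 0^'+, `|f (h *: v + (h *: w + x)) - f (h *: v + x)
     - f (h *: w + x) + f x - h ^+ 2 * 'D_w ('D_v f) x| <= e * h ^+ 2.
Proof.
move=> oU Ux df dg e0; set g := 'D_v f.
(* The points at which D_v f is evaluated are c v + h w + x and c v + x with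
   0 < c < h; the sum of their distances to x is at most h (2 |v| + |w|). *)
pose C := 2 * `|v| + `|w| + 1.
have C0 : 0 < C by rewrite ltr_wpDl// addr_ge0// mulr_ge0.
have [d d0 Hd] : exists2 d : R, 0 < d & forall y, `|y| < d ->
    U (y + x) /\ `|g (y + x) - g x - 'd g x y| <= e / C * `|y|.
  have eC : 0 < e / C by rewrite divr_gt0.
  have /diff_locally/eqaddoP/(_ _ eC) H1 := dg.
  have H2 : \forall y \near (0 : V), U (y + x).
    have : \near x, U x by exact: open_nbhs_nbhs.
    by rewrite (near_shift 0)/=; apply: filterS => y /=; rewrite subr0.
  have /nbhs_normP[d /= d0 Hd] : \forall y \near (0 : V), U (y + x) /\
      `|g (y + x) - g x - 'd g x y| <= e / C * `|y|.
    near=> y; split; first by near: y.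
    by rewrite -addrA -opprD; near: y; exact: H1.
  by exists d => // y yd; apply: Hd; rewrite /= sub0r normrN.
near=> h.
have h0 : 0 < h by near: h; exact: nbhs_right_gt.
have hd : h * C < d.
  by rewrite -ltr_pdivlMr//; near: h; apply: nbhs_right_lt; rewrite divr_gt0.
pose phi t := f (t *: v + (h *: w + x)) - f (t *: v + x).
have nv t : 0 <= t <= h -> `|t *: v| <= h * `|v|.
  by move=> /andP[t0 th]; rewrite normrZ ger0_norm// ler_wpM2r.
have nvw t : 0 <= t <= h -> `|t *: v + h *: w| <= h * (`|v| + `|w|).
  move=> th; rewrite (le_trans (ler_normD _ _))// mulrDr lerD ?nv//.
  by rewrite normrZ gtr0_norm.
have b1 t : 0 <= t <= h -> `|t *: v| < d.
  move=> th; apply: le_lt_trans hd; rewrite (le_trans (nv _ th))//.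
  rewrite ler_pM2l// /C; have := normr_ge0 w; have := normr_ge0 v; lra.
have b2 t : 0 <= t <= h -> `|t *: v + h *: w| < d.
  move=> th; apply: le_lt_trans hd; rewrite (le_trans (nvw _ th))//.
  rewrite ler_pM2l// /C; have := normr_ge0 w; have := normr_ge0 v; lra.
have dphi t : 0 <= t <= h ->
    is_derive t 1 phi (g (t *: v + (h *: w + x)) - g (t *: v + x)).
  move=> th; apply: is_deriveB.
    by apply: is_derive_line; apply: df; rewrite addrA; exact: (Hd _ (b2 _ th)).1.
  by apply: is_derive_line; apply: df; exact: (Hd _ (b1 _ th)).1.
have [|c|c] := @MVT R phi (fun t => g (t *: v + (h *: w + x)) - g (t *: v + x)) 0 h h0.
- by move=> t /[!in_itv]/= /andP[t0 th]; apply: dphi; rewrite !ltW.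
- apply: derivable_within_continuous => t; rewrite in_itv/= => th.
  by have [] := dphi t th.
rewrite in_itv/= => /andP[c0 ch].
have cc : 0 <= c <= h by rewrite !ltW.
rewrite /phi subr0 !scale0r !add0r => E.
have -> : f (h *: v + (h *: w + x)) - f (h *: v + x) - f (h *: w + x) + f x
   - h ^+ 2 * 'D_w g x
   = h * ((g ((c *: v + h *: w) + x) - g x - 'd g x (c *: v + h *: w))
          - (g (c *: v + x) - g x - 'd g x (c *: v))).
  have -> : 'd g x (c *: v + h *: w) = 'd g x (c *: v) + h * 'd g x w.
    by rewrite linearD; congr (_ + _); rewrite linearZ.
  rewrite (deriveE _ dg).
  transitivity (f (h *: v + (h *: w + x)) - f (h *: v + x) - (f (h *: w + x) - f x)
     - h ^+ 2 * 'd g x w); first by ring.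
  have alg (a b s r1 r2 k : R) : (a - b) * k - k ^+ 2 * r2 =
    k * (a - s - (r1 + k * r2) - (b - s - r1)) by ring.
  by rewrite E addrA; exact: alg.
rewrite normrM gtr0_norm// expr2 mulrCA ler_pM2l//.
have /= := (Hd _ (b2 _ cc)).2; have /= := (Hd _ (b1 _ cc)).2.
set A := g (_ + x) - _ - _; set B := g (_ + x) - _ - _ => HA HB.
rewrite (le_trans (ler_normB _ _))//.
have eC : 0 <= e / C by rewrite divr_ge0// ltW.
have H : e / C * `|c *: v + h *: w| + e / C * `|c *: v| <= e * h.
  rewrite -mulrDr -mulrA ler_pM2l// mulrC ler_pdivrMr//.
  have := nvw _ cc; have := nv _ cc; rewrite /C => n1 n2; lra.
by apply: le_trans H; rewrite lerD.
Unshelve. all: by end_near. Qed.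

(** The second difference is symmetric in v and w, and divided by h ^ 2 it
    tends to both iterated derivatives. *)
Lemma derive2C U (f : V -> R) (x v w : V) : open U -> U x ->
  (forall y, U y -> differentiable f y) ->
  differentiable ('D_v f) x -> differentiable ('D_w f) x ->
  'D_w ('D_v f) x = 'D_v ('D_w f) x.
Proof.
move=> oU Ux df dv dw; apply/eqP; rewrite -subr_eq0 -normr_le0.
apply/ler_addgt0Pr => e e0; rewrite add0r.
have e2 : 0 < e / 2 by rewrite divr_gt0.
have Hv := @second_difference U f x v w _ oU Ux df dv e2.
have Hw := @second_difference U f x w v _ oU Ux df dw e2.
have [h [h0 [Bv Bw]]] := filter_ex (filterI (nbhs_right_gt (0 : R)) (filterI Hv Hw)).
have h2 : 0 < h ^+ 2 by rewrite exprn_gt0.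
rewrite -(ler_pM2l h2) -[X in X * `|_|](gtr0_norm h2) -normrM.
rewrite addrCA in Bw.
have alg (a b c d p q k : R) :
  k * (p - q) = (a - c - b + d - k * q) - (a - b - c + d - k * p) by ring.
have -> : h ^+ 2 * ('D_w ('D_v f) x - 'D_v ('D_w f) x) =
  (f (h *: v + (h *: w + x)) - f (h *: w + x) - f (h *: v + x) + f x
    - h ^+ 2 * 'D_v ('D_w f) x) -
  (f (h *: v + (h *: w + x)) - f (h *: v + x) - f (h *: w + x) + f x
    - h ^+ 2 * 'D_w ('D_v f) x) by exact: alg.
rewrite (le_trans (ler_normB _ _))//; apply: le_trans (lerD Bw Bv) _.
by rewrite -mulrDl -splitr mulrC.
Qed.

End SymmetryOfSecondDerivatives.

(** * Derivatives of matrix-valued functions and Jacobians *)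

Section MatrixDerivatives.
Variables (R : realType) (V : normedModType R).

Lemma diff_sum (W : normedModType R) (I : finType) (f : I -> V -> W) x v :
  (forall i, differentiable (f i) x) ->
  differentiable (fun y => \sum_i f i y) x /\
  'D_v (fun y => \sum_i f i y) x = \sum_i 'D_v (f i) x.
Proof.
move=> df; elim: (index_enum I) => [|i r [IH1 IH2]].
  under eq_fun do rewrite big_nil; rewrite derive_cst big_nil.
  by split=> //; exact: differentiable_cst.
under eq_fun do rewrite big_cons; rewrite big_cons; split.
  exact: (@differentiableD _ _ _ (f i) (fun y => \sum_(j <- r) f j y)).
rewrite -IH2.
by apply: (@deriveD _ _ _ (f i) (fun y => \sum_(j <- r) f j y)); exact: diff_derivable.
Qed.

Lemma diff_mulmx n m l (f : V -> 'M[R]_(n, m)) (g : V -> 'M[R]_(m, l)) x :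
  differentiable f x -> differentiable g x ->
  differentiable (fun y => f y *m g y) x.
Proof.
move=> /diff_mxP df /diff_mxP dg; apply/diff_mxP => i j.
under eq_fun do rewrite mxE.
apply: (diff_sum 0 _).1 => k.
exact: (@differentiableM _ _ (fun y => f y i k) (fun y => g y k j)).
Qed.

Lemma derive_mulmx n m l (f : V -> 'M[R]_(n, m)) (g : V -> 'M[R]_(m, l)) x v :
  differentiable f x -> differentiable g x ->
  'D_v (fun y => f y *m g y) x = 'D_v f x *m g x + f x *m 'D_v g x.
Proof.
move=> df dg; apply/matrixP => i j.
rewrite derive_entry; last exact: diff_mulmx.
under eq_fun do rewrite mxE.
have /diff_mxP df' := df; have /diff_mxP dg' := dg.
have dM k : differentiable (fun y => f y i k * g y k j) x.
  exact: (@differentiableM _ _ (fun y => f y i k) (fun y => g y k j)).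
rewrite (diff_sum v dM).2 !mxE -big_split/=; apply: eq_bigr => k _.
rewrite (@deriveM _ _ (fun y => f y i k) (fun y => g y k j)); try exact: diff_derivable.
by rewrite (derive_entry _ _ _ df) (derive_entry _ _ _ dg) addrC; congr (_ + _); rewrite mulrC.
Qed.

Lemma diff_trmx n m (f : V -> 'M[R]_(n, m)) x :
  differentiable f x -> differentiable (fun y => (f y)^T) x.
Proof.
move=> /diff_mxP df; apply/diff_mxP => i j.
by under eq_fun do rewrite mxE.
Qed.

Lemma derive_trmx n m (f : V -> 'M[R]_(n, m)) x v :
  differentiable f x -> 'D_v (fun y => (f y)^T) x = ('D_v f x)^T.
Proof.
move=> df; apply/matrixP => i j; rewrite derive_entry; last exact: diff_trmx.
by rewrite mxE derive_entry//; congr ('D_v _ x); apply/funext => y; rewrite mxE.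
Qed.

Lemma smooth_mulmx n m l (U : set V) (f : V -> 'M[R]_(n, m)) (g : V -> 'M[R]_(m, l)) :
  open U -> smooth_on U f -> smooth_on U g -> smooth_on U (fun x => f x *m g x).
Proof. by move=> oU Cf Cg k; apply: class_C_mulmx. Qed.

Lemma smooth_mxP n m (U : set V) (f : V -> 'M[R]_(n, m)) : open U ->
  smooth_on U f <-> forall i j, smooth_on U (fun y => f y i j).
Proof.
move=> oU; split=> [Cf i j k|Cf k]; first exact: (class_C_mxP _ _ oU).1.
by apply/class_C_mxP => // i j; exact: Cf.
Qed.

Lemma smooth_diff (W : normedModType R) (U : set V) (f : V -> W) x :
  smooth_on U f -> U x -> differentiable f x.
Proof. by move=> /(_ 1%N)[df _] /df. Qed.

Lemma smooth_trmx n m (U : set V) (f : V -> 'M[R]_(n, m)) : open U ->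
  smooth_on U f -> smooth_on U (fun x => (f x)^T).
Proof.
move=> oU /(smooth_mxP _ oU) Cf; apply/smooth_mxP => // i j.
by under eq_fun do rewrite mxE; exact: Cf.
Qed.

Lemma smooth_det n (U : set V) (f : V -> 'M[R]_n) : open U ->
  smooth_on U f -> smooth_on U (fun x => \det (f x)).
Proof.
move=> oU /(smooth_mxP _ oU) Cf k; apply: class_C_sum => // /= s _; pose s' : 'S_n := s.
apply: (@class_CM R V k U (fun=> (-1) ^+ s') (fun x => \prod_i f x i (s' i))) => //.
  exact: class_C_cst.
by apply: class_C_prod => // i _; exact: Cf.
Qed.

Lemma smooth_eq (W : normedModType R) (U : set V) (f g : V -> W) : open U ->
  (forall x, U x -> f x = g x) -> smooth_on U f -> smooth_on U g.
Proof. by move=> oU fg Cf k; apply: class_C_eq (Cf k). Qed.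

Lemma smooth_le (W : normedModType R) (U U' : set V) (f : V -> W) :
  U' `<=` U -> smooth_on U f -> smooth_on U' f.
Proof. by move=> UU Cf k; apply: class_C_le (Cf k). Qed.

(** By Cramer's rule the entries of the inverse are polynomials in the entries
    of the matrix, divided by the determinant. *)
Lemma smooth_invmx n (U : set V) (f : V -> 'M[R]_n) : open U ->
  (forall x, U x -> f x \in unitmx) ->
  smooth_on U f -> smooth_on U (fun x => invmx (f x)).
Proof.
move=> oU fU Cf.
apply: (@smooth_eq _ _ (fun x => (\det (f x))^-1 *: \adj (f x))) => // [x Ux|].
  by rewrite /invmx fU.
apply/smooth_mxP => // i j k; under eq_fun do rewrite !mxE /cofactor.
apply: class_CM => //.
  apply: class_CV => //; last exact: smooth_det.
  by move=> x /fU; rewrite unitmxE unitfE.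
apply: (@class_CM R V k U (fun=> (-1) ^+ (j + i))
  (fun x => \det (row' j (col' i (f x))))) => //; first exact: class_C_cst.
apply: (@smooth_det _ U (fun x => row' j (col' i (f x)))) => //.
apply/smooth_mxP => // a b; under eq_fun do rewrite !mxE.
exact: (smooth_mxP _ oU).1.
Qed.

Lemma smoothD (W : normedModType R) (U : set V) (f g : V -> W) : open U ->
  smooth_on U f -> smooth_on U g -> smooth_on U (fun x => f x + g x).
Proof. by move=> oU Cf Cg k; apply: class_CD. Qed.

Lemma smooth_cst (W : normedModType R) (U : set V) (a : W) : smooth_on U (fun=> a).
Proof. by move=> k; exact: class_C_cst. Qed.

Lemma smooth_derive (W : normedModType R) (U : set V) (f : V -> W) v :
  smooth_on U f -> smooth_on U ('D_v f).
Proof. by move=> Cf k; have [_] := Cf k.+1; apply. Qed.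

Lemma derive_comp_rV n (W : normedModType R) (f : V -> 'rV[R]_n) (g : 'rV[R]_n -> W) x v :
  differentiable f x -> differentiable g (f x) ->
  'D_v (g \o f) x = 'D_('D_v f x) g (f x).
Proof.
move=> df dg; rewrite deriveE; last exact: differentiable_comp.
by rewrite diff_comp//= !deriveE.
Qed.

Lemma derive_sum_delta n (W : normedModType R) (g : 'rV[R]_n -> W) x v :
  differentiable g x -> 'D_v g x = \sum_l v 0 l *: 'D_'e_l g x.
Proof.
move=> dg; rewrite deriveE// {1}[v]row_sum_delta linear_sum.
by apply: eq_bigr => l _; rewrite linearZ/= deriveE.
Qed.

(** Induction on k with the chain rule in coordinates,
    D_v (g o f) = sum_l (D_v f)_l (D_l g o f), whose factors are of class k - 1. *)
Lemma class_C_comp n k (U : set V) (W : set 'rV[R]_n) (f : V -> 'rV[R]_n)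
    (g : 'rV[R]_n -> R) : open U -> (forall x, U x -> W (f x)) ->
  class_C k U f -> class_C k W g -> class_C k U (g \o f).
Proof.
move=> oU fUW; elim: k g => [|k IH] g.
  move=> cf cg x Ux; apply: continuous_comp; first exact: cf.
  by apply: cg; exact: fUW.
move=> Cf [dg Dg]; have [df Df] := Cf; split=> [x Ux|v].
  by apply: differentiable_comp; [exact: df|exact/dg/fUW].
pose h l x := ('D_v f x) 0 l * ('D_'e_l g \o f) x.
have Ch l : class_C k U (h l).
  apply: (@class_CM R V k U (fun x => ('D_v f x) 0 l) ('D_'e_l g \o f)) => //.
    by have /(class_C_mxP _ _ oU) := Df v; apply.
  by apply: IH (Dg _); exact: class_CW Cf.
have := @class_C_sum R V R k U _ (index_enum _) xpredT h oU (fun l _ => Ch l).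
apply: class_C_eq => // x Ux; have fxW := fUW x Ux.
by rewrite derive_comp_rV ?(derive_sum_delta _ (dg _ fxW))//; [exact: df|exact: dg].
Qed.

End MatrixDerivatives.

Section Jacobians.
Variable R : realType.

Lemma smooth_comp (V : normedModType R) n m l (U : set V) (W : set 'rV[R]_n)
    (f : V -> 'rV[R]_n) (g : 'rV[R]_n -> 'M[R]_(m, l)) : open U -> open W -> (forall x, U x -> W (f x)) ->
  smooth_on U f -> smooth_on W g -> smooth_on U (g \o f).
Proof.
move=> oU oW fUW Cf /(smooth_mxP _ oW) Cg; apply/smooth_mxP => // i j k.
exact: class_C_comp (Cg i j k).
Qed.


Lemma row_jacobian n m (f : 'rV[R]_n -> 'rV[R]_m) x i :
  differentiable f x -> row i (jacobian f x) = 'D_'e_i f x.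
Proof. by move=> df; rewrite rowE deriveEjacobian. Qed.

Lemma smooth_jacobian n m (U : set 'rV[R]_n) (f : 'rV[R]_n -> 'rV[R]_m) :
  open U -> smooth_on U f -> smooth_on U (jacobian f).
Proof.
move=> oU Cf; apply/smooth_mxP => // i j.
apply: (@smooth_eq _ _ _ _ (fun x => ('D_'e_i f x) 0 j)) => // [x Ux|].
  by rewrite -row_jacobian ?mxE//; exact: smooth_diff Cf Ux.
exact/(smooth_mxP _ oU).1/smooth_derive.
Qed.

Lemma jacobian_comp n m l (f : 'rV[R]_n -> 'rV[R]_m) (g : 'rV[R]_m -> 'rV[R]_l) x :
  differentiable f x -> differentiable g (f x) ->
  jacobian (g \o f) x = jacobian f x *m jacobian g (f x).
Proof.
move=> df dg; apply/row_matrixP => i; rewrite row_jacobian; last exact: differentiable_comp.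
by rewrite derive_comp_rV// deriveEjacobian// -row_jacobian// row_mul.
Qed.

Lemma near_eq_jacobian n m (f g : 'rV[R]_n -> 'rV[R]_m) x :
  differentiable f x -> {near x, f =1 g} -> jacobian f x = jacobian g x.
Proof.
move=> df fg; have dg := near_eq_diff fg df.
apply/row_matrixP => i.
rewrite [LHS](row_jacobian i df).
rewrite [RHS](row_jacobian i dg).
exact: (near_eq_derive _ fg).
Qed.

(** Both sides are iterated derivatives of f, since w J f = D_w f; this is the
    symmetry of the second derivatives. *)
Lemma derive_jacobianC n m (U : set 'rV[R]_n) (f : 'rV[R]_n -> 'rV[R]_m) x v w :
  open U -> U x -> smooth_on U f ->
  w *m 'D_v (jacobian f) x = v *m 'D_w (jacobian f) x.
Proof.
move=> oU Ux Cf.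
have key (a b : 'rV[R]_n) : b *m 'D_a (jacobian f) x = 'D_a ('D_b f) x.
  have dJ : differentiable (jacobian f) x by exact: smooth_diff (smooth_jacobian oU Cf) Ux.
  have := derive_mulmx (f := fun=> b) (g := jacobian f) a (differentiable_cst b x) dJ.
  rewrite derive_cst mul0mx add0r => <-; apply: near_eq_derive.
  apply: open_near_eq oU Ux _ => y Uy.
  by rewrite deriveEjacobian//; exact: smooth_diff Cf Uy.
have dD a : differentiable ('D_a f) x by exact: smooth_diff (smooth_derive a Cf) Ux.
have E a j : {near x, (fun y => ('D_a f y) 0 j) =1 'D_a (fun y => f y 0 j)}.
  apply: open_near_eq oU Ux _ => y Uy.
  exact: (derive_entry _ _ _ (smooth_diff Cf Uy)).
have dj a j : differentiable ('D_a (fun y => f y 0 j)) x.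
  by apply: near_eq_diff (E a j) _; have /diff_mxP := dD a; exact.
rewrite [LHS]key [RHS]key; apply/rowP => j.
rewrite [LHS](derive_entry _ _ _ (dD w)) [RHS](derive_entry _ _ _ (dD v)).
rewrite [LHS](near_eq_derive _ (E w j)) [RHS](near_eq_derive _ (E v j)).
apply: (derive2C oU Ux); [|exact: dj|exact: dj] => y Uy.
by have /diff_mxP := smooth_diff Cf Uy; apply.
Qed.

End Jacobians.

(** * Calculus in the charts of a manifold *)

Section Charts.
Variables (R : realType) (n : nat) (M : manifold R n).
Implicit Types (c d e : chart R n M) (U : set M) (p q : M).

Definition chart_image c U := cmap c @` (cdom c `&` U).

Lemma cinv_img c U u : chart_image c U u ->
  [/\ cdom c (cinv c u), U (cinv c u) & cmap c (cinv c u) = u].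
Proof. by move=> [q [cq Uq] <-]; rewrite cmapK. Qed.

Lemma img_cmap c U q : cdom c q -> U q -> chart_image c U (cmap c q).
Proof. by move=> cq Uq; exists q. Qed.

Lemma chart_imageT c : chart_image c setT = cmap c @` cdom c.
Proof. by rewrite /chart_image setIT. Qed.

Lemma chart_image_le c U U' : U `<=` U' -> chart_image c U `<=` chart_image c U'.
Proof. by move=> UU _ [q [cq Uq] <-]; exists q => //; split=> //; exact: UU. Qed.

Lemma continuous_cinv c q : cdom c q -> {for (cmap c q), continuous (cinv c)}.
Proof. by move=> cq; apply: cinv_continuous; exists q. Qed.

Lemma open_chart_image c U : open U -> open (chart_image c U).
Proof.
move=> oU; rewrite openE => _ [q [cq Uq] <-]; rewrite /interior.
have H1 : \forall u \near cmap c q, U (cinv c u).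
  apply: (continuous_cinv cq); rewrite cmapK//; exact: open_nbhs_nbhs.
have H2 : \forall u \near cmap c q, (cmap c @` cdom c) u.
  by apply: open_nbhs_nbhs; split; [exact: cimg_open|exists q].
near=> u; have [q' cq' E] : (cmap c @` cdom c) u by near: u.
exists q' => //; split=> //; rewrite -(cmapK cq') E; near: u; exact: H1.
Unshelve. all: by end_near. Qed.

Arguments open_chart_image c {U} _.

(** Near x the map phi stays in the domain of the chart d, so that
    psi o phi = (psi o d^-1) o (d o phi) there. *)
Lemma jacobian_through k l (phi : 'rV[R]_k -> M) (psi : M -> 'rV[R]_l) x d :
  {for x, continuous phi} -> cdom d (phi x) ->
  differentiable (cmap d \o phi) x ->
  differentiable (psi \o cinv d) (cmap d (phi x)) ->
  differentiable (psi \o phi) x /\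
  jacobian (psi \o phi) x =
    jacobian (cmap d \o phi) x *m jacobian (psi \o cinv d) (cmap d (phi x)).
Proof.
move=> cphi dphi D1 D2.
have near_eq : {near x, (psi \o cinv d) \o (cmap d \o phi) =1 psi \o phi}.
  have : \forall y \near x, cdom d (phi y).
    by apply: cphi; apply: open_nbhs_nbhs; split=> //; exact: cdom_open.
  by apply: filterS => y dy /=; rewrite cmapK.
have D : differentiable ((psi \o cinv d) \o (cmap d \o phi)) x.
  exact: differentiable_comp.
split; first exact: near_eq_diff near_eq D.
by rewrite -(near_eq_jacobian D near_eq) jacobian_comp.
Qed.

Definition transition c d q : 'M[R]_n := jacobian (cmap d \o cinv c) (cmap c q).

Lemma diff_transition c d q : atlas c -> atlas d -> cdom c q -> cdom d q ->
  differentiable (cmap d \o cinv c) (cmap c q).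
Proof.
move=> ac ad cq dq; have := atlas_compatible ac ad.
by move/smooth_diff; apply; exists q.
Qed.

Lemma transition_comp c d e q : atlas c -> atlas d -> atlas e ->
  cdom c q -> cdom d q -> cdom e q ->
  transition c d q *m transition d e q = transition c e q.
Proof.
move=> ac ad ae cq dq eq; rewrite /transition.
have [||||_ ->] := @jacobian_through n n (cinv c) (cmap e) (cmap c q) d.
- exact: continuous_cinv.
- by rewrite cmapK.
- exact: diff_transition.
- by rewrite cmapK//; exact: diff_transition.
- by rewrite cmapK.
Qed.

Lemma transition_id c q : atlas c -> cdom c q -> transition c c q = 1%:M.
Proof.
move=> ac cq; have H : {near cmap c q, cmap c \o cinv c =1 id}.
  have : \forall u \near cmap c q, (cmap c @` cdom c) u.
    by apply: open_nbhs_nbhs; split; [exact: cimg_open|exists q].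
  by apply: filterS => _ [q' cq' <-] /=; rewrite cmapK.
rewrite /transition (near_eq_jacobian _ H); last exact: diff_transition.
by apply/row_matrixP => i; rewrite row_jacobian// derive_id rowE mulmx1.
Qed.

Lemma transitionK c d q : atlas c -> atlas d -> cdom c q -> cdom d q ->
  transition c d q *m transition d c q = 1%:M.
Proof. by move=> *; rewrite transition_comp// transition_id. Qed.

Lemma to_of_chart c q : atlas c -> cdom c q -> to_chart c q *m of_chart c q = 1%:M.
Proof.
move=> ac cq; apply: transitionK => //; [exact: chart_at_atlas|exact: chart_at_dom].
Qed.

(** Smoothness of a matrix of functions on M; a chart enters only through the
    base point, whereas the components of a vector field change with it. *)
Definition smooth_matrix k l U (A : M -> 'M[R]_(k, l)) : Prop :=
  forall c, atlas c -> smooth_on (chart_image c U) (A \o cinv c).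

(** The rows of E are k vector fields, read simultaneously in the chart c. *)
Definition local_frame k c (E : M -> 'M[R]_(k, n)) (u : 'rV[R]_n) : 'M[R]_(k, n) :=
  E (cinv c u) *m to_chart c (cinv c u).

Definition smooth_frame k U (E : M -> 'M[R]_(k, n)) : Prop :=
  forall c, atlas c -> smooth_on (chart_image c U) (local_frame c E).

Lemma row_local_frame k c (E : M -> 'M[R]_(k, n)) i u :
  row i (local_frame c E u) = local_field c (frame_field E i) u.
Proof. by rewrite /local_frame row_mul. Qed.

Lemma smooth_frameP k U (E : M -> 'M[R]_(k, n)) : open U ->
  smooth_frame U E <-> forall i, smooth_field U (frame_field E i).
Proof.
move=> oU; split=> [sE i c ac|sE c ac]; have oI := open_chart_image c oU.
  apply/smooth_mxP => // a j.
  have := (smooth_mxP _ oI).1 (sE c ac) i j; apply: smooth_eq => // u _.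
  by rewrite (ord1 a) -row_local_frame [RHS]mxE.
apply/smooth_mxP => // i j.
have := (smooth_mxP _ oI).1 (sE i c ac) 0 j; apply: smooth_eq => // u _.
by rewrite -row_local_frame [LHS]mxE.
Qed.

Lemma smooth_matrix_le k l U U' (A : M -> 'M[R]_(k, l)) :
  U' `<=` U -> smooth_matrix U A -> smooth_matrix U' A.
Proof. by move=> UU sA c ac; apply: smooth_le (sA c ac); exact: chart_image_le. Qed.

Lemma smooth_frame_le k U U' (E : M -> 'M[R]_(k, n)) :
  U' `<=` U -> smooth_frame U E -> smooth_frame U' E.
Proof. by move=> UU sA c ac; apply: smooth_le (sA c ac); exact: chart_image_le. Qed.

Lemma smooth_matrix_mul k l m U (A : M -> 'M[R]_(k, l)) (B : M -> 'M[R]_(l, m)) :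
  open U -> smooth_matrix U A -> smooth_matrix U B ->
  smooth_matrix U (fun q => A q *m B q).
Proof.
move=> oU sA sB c ac.
exact: (smooth_mulmx (open_chart_image c oU) (sA c ac) (sB c ac)).
Qed.

Lemma smooth_matrix_tr k l U (A : M -> 'M[R]_(k, l)) : open U ->
  smooth_matrix U A -> smooth_matrix U (fun q => (A q)^T).
Proof.
move=> oU sA c ac; exact: (smooth_trmx (open_chart_image c oU) (sA c ac)).
Qed.

Lemma smooth_matrixD k l U (A B : M -> 'M[R]_(k, l)) : open U ->
  smooth_matrix U A -> smooth_matrix U B -> smooth_matrix U (fun q => A q + B q).
Proof.
move=> oU sA sB c ac.
exact: (smoothD (open_chart_image c oU) (sA c ac) (sB c ac)).
Qed.

Lemma smooth_matrix_cst k l U (A : 'M[R]_(k, l)) : smooth_matrix U (fun=> A).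
Proof. by move=> c ac; exact: smooth_cst. Qed.

Lemma smooth_matrixB k l U (A B : M -> 'M[R]_(k, l)) : open U ->
  smooth_matrix U A -> smooth_matrix U B -> smooth_matrix U (fun q => A q - B q).
Proof.
move=> oU sA sB; apply: smooth_matrixD => // c ac.
have oI := open_chart_image c oU.
have := smooth_mulmx oI (smooth_cst _ (- 1%:M)) (sB c ac).
by apply: smooth_eq => // u _; rewrite mulNmx mul1mx.
Qed.

Lemma smooth_matrix_inv k U (A : M -> 'M[R]_k) : open U ->
  (forall q, U q -> A q \in unitmx) ->
  smooth_matrix U A -> smooth_matrix U (fun q => invmx (A q)).
Proof.
move=> oU uA sA c ac; have oI := open_chart_image c oU.
by apply: (smooth_invmx oI _ (sA c ac)) => u /cinv_img[_ Uu _]; exact: uA.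
Qed.

Lemma smooth_matrix_continuous k l U (A : M -> 'M[R]_(k, l)) p : open U -> U p ->
  smooth_matrix U A -> {for p, continuous A}.
Proof.
move=> oU Up sA; set c := chart_at p.
have cp : cdom c p by exact: chart_at_dom.
have ac : atlas c by exact: chart_at_atlas.
have cA := sA c ac 0%N _ (img_cmap cp Up).
rewrite /prop_for /continuous_at.
have : (A \o cinv c) \o cmap c @ p --> A p.
  have -> : A p = (A \o cinv c) (cmap c p) by rewrite /= cmapK.
  apply: (@continuous_comp _ _ _ (cmap c) (A \o cinv c) p) => //.
  exact: cmap_continuous.
apply: cvg_trans; apply: near_eq_cvg.
have : nbhs p (cdom c) by apply: open_nbhs_nbhs; split=> //; exact: cdom_open.
by apply: filterS => q cq /=; rewrite cmapK.
Qed.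

Lemma smooth_frame_mul k l U (A : M -> 'M[R]_(k, l)) (E : M -> 'M[R]_(l, n)) :
  open U -> smooth_matrix U A -> smooth_frame U E ->
  smooth_frame U (fun q => A q *m E q).
Proof.
move=> oU sA sE c ac; have oI := open_chart_image c oU.
have := smooth_mulmx oI (sA c ac) (sE c ac).
by apply: smooth_eq => // u _; rewrite /local_frame /= mulmxA.
Qed.

Lemma gram_change_basis k l a b (X : 'M[R]_(k, a)) (Y : 'M[R]_(l, a))
    (T : 'M[R]_(a, b)) (O : 'M[R]_(b, a)) (G : 'M[R]_a) : T *m O = 1%:M ->
  X *m T *m (O *m G *m O^T) *m (Y *m T)^T = X *m G *m Y^T.
Proof.
move=> TO; rewrite trmx_mul !mulmxA -(mulmxA X T O) TO mulmx1.
by rewrite -(mulmxA _ O^T) -trmx_mul TO trmx1 mulmx1.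
Qed.

(** The inner products of two vectors do not depend on the coordinates in
    which the vectors and the metric are read. *)
Lemma local_gram k l c g (E : M -> 'M[R]_(k, n)) (E' : M -> 'M[R]_(l, n)) u :
  atlas c -> cdom c (cinv c u) ->
  local_frame c E u *m local_metric c g u *m (local_frame c E' u)^T
  = E (cinv c u) *m g (cinv c u) *m (E' (cinv c u))^T.
Proof.
move=> ac cu; rewrite /local_frame /local_metric.
have := to_of_chart ac cu.
move: (to_chart c (cinv c u)) (of_chart c (cinv c u)) => T O TO.
exact: gram_change_basis.
Qed.

Lemma smooth_gram k l U (g : M -> 'M[R]_n) (E : M -> 'M[R]_(k, n))
    (E' : M -> 'M[R]_(l, n)) : open U -> riemannian_metric g ->
  smooth_frame U E -> smooth_frame U E' ->
  smooth_matrix U (fun q => E q *m g q *m (E' q)^T).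
Proof.
move=> oU [_ _ sg] sE sE' c ac; have oI := open_chart_image c oU.
have sg' : smooth_on (chart_image c U) (local_metric c g).
  by apply: smooth_le (sg c ac); rewrite -chart_imageT; exact: chart_image_le.
have := smooth_mulmx oI (smooth_mulmx oI (sE c ac) sg') (smooth_trmx oI (sE' c ac)).
apply: smooth_eq => // u /cinv_img[cu _ _]; exact: local_gram.
Qed.

End Charts.

Arguments open_chart_image {R n M} c {U} _.

(** * Smooth maps in charts *)

Section MapsInCharts.
Variables (R : realType) (n m : nat) (M : manifold R n) (N : manifold R m).
Variables (F : M -> N) (sF : smooth_map F).
Implicit Types (c : chart R n M) (d : chart R m N) (U : set M) (p q : M).

Definition local_map c d := cmap d \o F \o cinv c.

Lemma open_preimage d : open (F @^-1` cdom d).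
Proof. by apply: open_comp; [move=> x _; exact: sF.1|exact: cdom_open]. Qed.

Lemma smooth_local_map c d U : atlas c -> atlas d -> U `<=` F @^-1` cdom d ->
  smooth_on (chart_image c U) (local_map c d).
Proof.
by move=> ac ad UF; apply: smooth_le (sF.2 c d ac ad); exact: chart_image_le.
Qed.

Lemma diff_local_map c d q : atlas c -> atlas d -> cdom c q -> cdom d (F q) ->
  differentiable (local_map c d) (cmap c q).
Proof.
move=> ac ad cq dq.
by apply: smooth_diff (smooth_local_map (U := F @^-1` cdom d) ac ad _) _ => //; exact: img_cmap.
Qed.

(** The chain rule applied twice: through the preferred chart at F q on the
    side of N, and through c on the side of M. *)
Lemma differential_to_chart c d q : atlas c -> atlas d ->
  cdom c q -> cdom d (F q) ->
  differential F q *m to_chart d (F q)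
  = to_chart c q *m jacobian (local_map c d) (cmap c q).
Proof.
move=> ac ad cq dq.
have [aq q0] := (chart_at_atlas q, chart_at_dom q).
have [aF F0] := (chart_at_atlas (F q), chart_at_dom (F q)).
transitivity (jacobian (local_map (chart_at q) d) (cmap (chart_at q) q)).
  have [||||_ ->] := @jacobian_through _ _ N _ _ (F \o cinv (chart_at q))
    (cmap d) (cmap (chart_at q) q) (chart_at (F q)).
  - apply: continuous_comp; first exact: continuous_cinv.
    exact: sF.1.
  - by rewrite /= cmapK.
  - exact: diff_local_map.
  - by rewrite /= cmapK//; exact: diff_transition.
  - by rewrite /= cmapK.
have [||||_ E] := @jacobian_through _ _ M _ _ (cinv (chart_at q))
    (cmap d \o F) (cmap (chart_at q) q) c.
- exact: continuous_cinv.
- by rewrite cmapK.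
- exact: diff_transition.
- by rewrite cmapK//; exact: diff_local_map.
- by apply: etrans E _; rewrite (cmapK q0).
Qed.

Lemma local_pushforward k c d (E : M -> 'M[R]_(k, n)) u : atlas c -> atlas d ->
  cdom c (cinv c u) -> cmap c (cinv c u) = u -> cdom d (F (cinv c u)) ->
  E (cinv c u) *m differential F (cinv c u) *m to_chart d (F (cinv c u))
  = local_frame c E u *m jacobian (local_map c d) u.
Proof.
move=> ac ad cu uE du.
have D := differential_to_chart ac ad cu du; rewrite uE in D.
by rewrite -mulmxA D mulmxA.
Qed.

(** Smoothness is a local property, and near a point F takes values in a single
    chart of N, where the pushed forward fields are given by the Jacobian of F. *)
Lemma smooth_pushforward_gram k l U (g : N -> 'M[R]_m) (E : M -> 'M[R]_(k, n))
    (E' : M -> 'M[R]_(l, n)) : open U -> riemannian_metric g ->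
  smooth_frame U E -> smooth_frame U E' ->
  smooth_matrix U (fun q => E q *m differential F q *m g (F q)
    *m (E' q *m differential F q)^T).
Proof.
move=> oU [_ _ sg] sE sE' c ac j; apply: class_C_local => u Uu.
have [cu Ucu uE] := cinv_img Uu; set d := chart_at (F (cinv c u)).
have ad : atlas d by exact: chart_at_atlas.
pose U' := U `&` F @^-1` cdom d.
have oU' : open U' by apply: openI => //; exact: open_preimage.
have oI := open_chart_image c oU'.
exists (chart_image c U').
  by rewrite -uE; apply: img_cmap => //; split=> //; exact: chart_at_dom.
move: j; rewrite -/(smooth_on _ _).
have UU : chart_image c U' `<=` chart_image c U by apply: chart_image_le => q [].
have sl := smooth_local_map (U := U') ac ad (fun q => @proj2 _ _).
have sJ := smooth_jacobian oI sl.
have s1 := smooth_mulmx oI (smooth_le UU (sE c ac)) sJ.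
have s2 := smooth_mulmx oI (smooth_le UU (sE' c ac)) sJ.
have od : open (cmap d @` cdom d) by exact: cimg_open.
have sG : smooth_on (chart_image c U') (local_metric d g \o local_map c d).
  apply: smooth_comp od _ sl (sg d ad) => // v /cinv_img[cv [_ dv] _].
  by exists (F (cinv c v)).
have H := smooth_mulmx oI (smooth_mulmx oI s1 sG) (smooth_trmx oI s2).
apply: (smooth_eq oI _ H) => v /cinv_img[cv [_ dv] vE].
rewrite -(local_pushforward E ac ad cv vE dv) -(local_pushforward E' ac ad cv vE dv).
have -> : (local_metric d g \o local_map c d) v = of_chart d (F (cinv c v))
    *m g (F (cinv c v)) *m (of_chart d (F (cinv c v)))^T.
  by rewrite /comp /local_metric /local_map /comp (cmapK dv).
have := to_of_chart ad dv.
move: (to_chart d _) (of_chart d _) => T O TO.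
exact: gram_change_basis.
Qed.

End MapsInCharts.

(** * Orthogonal projections *)

Section EuclideanLinearAlgebra.
Variables (R : realType) (n : nat).
Implicit Types (G : 'M[R]_n).

Lemma sub_orth k l G (A : 'M[R]_(k, n)) (B : 'M[R]_(l, n)) :
  (B <= orth G A)%MS = (B *m G *m A^T == 0).
Proof. by rewrite sub_kermx mulmxA. Qed.

Definition positive_definite G := forall v : 'rV[R]_n, v != 0 -> 0 < inner G v v.

Lemma posdef_eq0 G (v : 'rV[R]_n) : positive_definite G -> v *m G *m v^T = 0 -> v = 0.
Proof.
move=> pG v0; apply/eqP/negPn/negP => /pG.
by rewrite /inner v0 mxE ltxx.
Qed.

Lemma posdef_unit G : positive_definite G -> G \in unitmx.
Proof.
move=> pG; rewrite -row_free_unit; apply/inj_row_free => v vG.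
by apply: (posdef_eq0 pG); rewrite vG mul0mx.
Qed.

Lemma capmx_orth k G (D : 'M[R]_(k, n)) : positive_definite G ->
  (D :&: orth G D)%MS = 0.
Proof.
move=> pG; apply/eqP; rewrite -submx0; apply/rV_subP => v.
rewrite sub_capmx sub_orth => /andP[/submxP[y yE] /eqP vD].
have -> : v = 0; last exact: sub0mx.
by apply: (posdef_eq0 pG); rewrite {2}yE trmx_mul mulmxA vD mul0mx.
Qed.

(** The sum is direct and G is invertible, so a dimension count suffices. *)
Lemma addsmx_orth k G (D : 'M[R]_(k, n)) : positive_definite G ->
  (1%:M <= D + orth G D)%MS.
Proof.
move=> pG; rewrite sub1mx /row_full mxrank_disjoint_sum ?capmx_orth//.
rewrite mxrank_ker eqmxMfull ?mxrank_tr ?subnKC ?rank_leq_col//.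
by rewrite row_full_unit posdef_unit.
Qed.

Lemma orthonormal_basis_unit G (E : 'M[R]_n) : E *m G *m E^T = 1%:M ->
  [/\ E \in unitmx, G \in unitmx & E^T *m E = invmx G].
Proof.
move=> EGE.
have [uEG _] := mulmx1_unit EGE.
move: (uEG); rewrite unitmx_mul => /andP[uE uG]; split=> //.
have H : G *m (E^T *m E) = 1%:M.
  by apply: mulmx1C; rewrite -mulmxA; exact: mulmx1C.
by rewrite -[LHS](mulKmx uG) H mulmx1.
Qed.

(** The endomorphism P = J h J^T G^-1 is J followed by its adjoint.  Since J is
    an isometry on the orthogonal complement of its kernel, P is the orthogonal
    projection onto that complement, and S is its matrix in the orthonormal basis
    E.  Written in this way, the projection depends smoothly on E, J and h. *)
Lemma horizontal_projection m G (E : 'M[R]_n) (h : 'M[R]_m) (J : 'M[R]_(n, m)) :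
  G^T = G -> h^T = h -> positive_definite G -> E *m G *m E^T = 1%:M ->
  (forall v w, (v <= orth G (kermx J))%MS -> (w <= orth G (kermx J))%MS ->
     inner h (v *m J) (w *m J) = inner G v w) ->
  let S := E *m J *m h *m (E *m J)^T in
  [/\ S^T = S, S *m S = S, (S *m E :=: orth G (kermx J))%MS &
      forall k (x : 'M[R]_(k, n)), x *m S = 0 <-> x *m E *m J = 0].
Proof.
move=> GT hT pG EGE iso; set H := orth G (kermx J) => S.
have [uE uG EE] := orthonormal_basis_unit EGE.
pose P := J *m h *m J^T *m invmx G.
have SE : S *m E = E *m P.
  by rewrite /S /P trmx_mul !mulmxA -(mulmxA _ E^T) EE.
have Pker k (x : 'M[R]_(k, n)) : x *m J = 0 -> x *m P = 0.
  by move=> xJ; rewrite /P !mulmxA xJ !mul0mx.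
have PH1 (v : 'rV[R]_n) : (v <= H)%MS -> v *m P = v.
  (* The difference z between v P and v is orthogonal to ker J and, by the
     isometry property, to H. *)
  move=> vH; apply/eqP; rewrite -subr_eq0; apply/eqP; set z := _ - v.
  have zw (w : 'rV[R]_n) : z *m G *m w^T = 0.
    have zG : z *m G = v *m J *m h *m J^T - v *m G.
      by rewrite /z /P mulmxBl !mulmxA mulmxKV.
    have /sub_addsmxP[[a b] wE] : (w <= kermx J + H)%MS.
      by apply: submx_trans (addsmx_orth _ pG); exact: submx1.
    rewrite wE linearD mulmxDr /= zG.
    have -> : (v *m J *m h *m J^T - v *m G) *m (a *m kermx J)^T = 0.
      rewrite trmx_mul mulmxA mulmxBl.
      have -> : v *m J *m h *m J^T *m (kermx J)^T = 0.
        by rewrite -mulmxA -trmx_mul mulmx_ker trmx0 mulmx0.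
      by move: vH; rewrite sub_orth => /eqP->; rewrite subrr mul0mx.
    rewrite add0r; have bH : (b *m H <= H)%MS by exact: submxMl.
    apply/matrixP => i j; rewrite !ord1 mulmxBl !mxE.
    apply/eqP; rewrite subr_eq0; apply/eqP.
    by have := iso _ _ vH bH; rewrite /inner trmx_mul !mulmxA mxE => ->; rewrite mxE.
  by apply: (posdef_eq0 pG); rewrite zw.
have PH k (x : 'M[R]_(k, n)) : (x <= H)%MS -> x *m P = x.
  move=> xH; apply/row_matrixP => i; rewrite row_mul PH1//.
  exact: submx_trans (row_sub _ _) xH.
have PinH : (P <= H)%MS.
  have /sub_addsmxP[[a b] E1] : (1%:M <= kermx J + H)%MS by exact: addsmx_orth.
  rewrite -[P]mul1mx E1 mulmxDl Pker ?add0r; last by rewrite -mulmxA mulmx_ker mulmx0.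
  by rewrite PH submxMl.
have PP : P *m P = P by exact: PH.
split.
- by rewrite /S !trmx_mul !trmxK hT !mulmxA.
- have : S *m S *m E = S *m E by rewrite -mulmxA SE mulmxA SE -mulmxA PP.
  by move/(can_inj (mulmxK uE)).
- apply/eqmxP/andP; rewrite SE; split; first exact: submx_trans (submxMl _ _) PinH.
  by apply/submxP; exists (H *m invmx E); rewrite [RHS]mulmxA mulmxKV// PH.
- move=> k x; split=> [xS|xEJ]; last by rewrite /S !mulmxA xEJ !mul0mx.
  have xEP : x *m E *m P = 0 by rewrite -mulmxA -SE mulmxA xS mul0mx.
  have /sub_addsmxP[[a b] xE] : (x *m E <= kermx J + H)%MS.
    by apply: submx_trans (addsmx_orth _ pG); exact: submx1.
  move: xEP; rewrite xE mulmxDl Pker ?add0r; last by rewrite -mulmxA mulmx_ker mulmx0.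
  rewrite PH ?submxMl// => ->; rewrite addr0 -mulmxA mulmx_ker mulmx0 //.
Qed.

Lemma sum_squares_eq0 k (w : 'rV[R]_k) : w *m w^T = 0 -> w = 0.
Proof.
move=> /matrixP/(_ 0 0); rewrite mxE [RHS]mxE.
under eq_bigr do rewrite [w^T _ _]mxE -expr2.
move=> /eqP; rewrite psumr_eq0 => [/allP H|i _]; last exact: sqr_ge0.
apply/rowP => j; rewrite [RHS]mxE; apply/eqP.
by have := H j (mem_index_enum j); rewrite sqrf_eq0.
Qed.

Lemma rowspace_projection k (A : 'M[R]_(k, n)) : row_free A ->
  A *m A^T \in unitmx /\
  let S := A^T *m invmx (A *m A^T) *m A in
  [/\ S^T = S, S *m S = S, (S :=: A)%MS & A *m S = A].
Proof.
move=> fA.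
have uG : A *m A^T \in unitmx.
  rewrite -row_free_unit; apply/inj_row_free => v vAA.
  have : v *m A *m (v *m A)^T = 0 by rewrite trmx_mul !mulmxA -(mulmxA v) vAA mul0mx.
  move=> /sum_squares_eq0 vA0.
  by apply: (row_free_inj fA); rewrite vA0 mul0mx.
split=> // S.
have AS : A *m S = A by rewrite /S !mulmxA mulmxV// mul1mx.
split=> //.
- rewrite /S !trmx_mul trmxK mulmxA; congr (_ *m _ *m _).
  by rewrite trmx_inv trmx_mul trmxK.
- by rewrite {1}/S -!mulmxA AS !mulmxA.
- apply/eqmxP/andP; split; first exact: submxMl.
  by rewrite -{1}AS submxMl.
Qed.

Lemma projection_row (S : 'M[R]_n) i : S^T = S -> S *m S = S ->
  row i S *m (row i S)^T = (S i i)%:M.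
Proof.
move=> ST SS; rewrite tr_row ST rowE colE mulmxA -(mulmxA _ S S) SS -rowE -colE.
by apply/matrixP => x y; rewrite !ord1 !mxE eqxx mulr1n.
Qed.

(** From S <= T and T <= S follow S T = S and T S = T; transposing the second
    one gives S T = T. *)
Lemma projection_unique (S T : 'M[R]_n) : S^T = S -> T^T = T -> S *m S = S ->
  T *m T = T -> (S :=: T)%MS -> S = T.
Proof.
move=> ST TT SS TTT ST'.
have H (A B : 'M[R]_n) : B *m B = B -> (A <= B)%MS -> A *m B = A.
  by move=> BB /submxP[D ->]; rewrite -mulmxA BB.
have H1 : S *m T = S by apply: H => //; rewrite ST'.
have H2 : T *m S = T by apply: H => //; rewrite ST'.
by rewrite -[RHS]TT -H2 trmx_mul ST TT H1.
Qed.

(** SH and S1 are the projections onto the horizontal space and onto D, in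
    coordinates with respect to E.  As D lies in ker J, these two spaces are
    orthogonal, and what remains is the part of ker J orthogonal to D. *)
Lemma complement_projection m k G (E : 'M[R]_n) (J : 'M[R]_(n, m)) (SH D : 'M[R]_n)
    (A1 : 'M[R]_(k, n)) (S1 := A1^T *m invmx (A1 *m A1^T) *m A1) :
  E *m G *m E^T = 1%:M -> SH^T = SH -> SH *m SH = SH ->
  (forall l (x : 'M[R]_(l, n)), x *m SH = 0 <-> x *m E *m J = 0) ->
  row_free A1 -> (A1 *m E :=: D)%MS -> (D <= kermx J)%MS ->
  let S2 := 1%:M - SH - S1 in
  [/\ S2^T = S2, S2 *m S2 = S2 & (S2 *m E :=: kermx J :&: orth G D)%MS].
Proof.
move=> EGE SHT SHSH H0 fA1 A1D Dker.
have [uE _ _] := orthonormal_basis_unit EGE.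
have [S1T S1S1 AS1] : [/\ S1^T = S1, S1 *m S1 = S1 & A1 *m S1 = A1].
  by have [_ []] := rowspace_projection fA1.
have A1J : A1 *m E *m J = 0.
  by apply/eqP; rewrite -sub_kermx; apply: submx_trans Dker; rewrite A1D.
have yS1 l (y : 'M[R]_(l, n)) : y *m A1^T = 0 -> y *m S1 = 0.
  by move=> yA; rewrite /S1 !mulmxA yA !mul0mx.
have S1A : S1 *m A1^T = A1^T by rewrite -S1T -trmx_mul AS1.
have S1H : S1 *m SH = 0.
  by rewrite /S1 -mulmxA (H0 _ A1).2// mulmx0.
have HS1 : SH *m S1 = 0.
  by rewrite -SHT -S1T -trmx_mul S1H trmx0.
move: S1 S1T S1S1 AS1 yS1 S1A S1H HS1 => S1 S1T S1S1 AS1 yS1 S1A S1H HS1 S2.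
have S2H : S2 *m SH = 0.
  by rewrite /S2 !mulmxBl mul1mx SHSH S1H subrr subr0.
have S2S1 : S2 *m S1 = 0.
  by rewrite /S2 !mulmxBl mul1mx S1S1 HS1 subr0 subrr.
have S2A1 : S2 *m A1^T = 0 by rewrite -S1A mulmxA S2S1 mul0mx.
split.
- by rewrite /S2 !linearB/= trmx1 SHT S1T.
- by rewrite {2}/S2 !mulmxBr mulmx1 S2H S2S1 !subr0.
apply/eqmxP/andP; split.
  rewrite sub_capmx sub_kermx (H0 n S2).1 ?S2H// eqxx sub_orth /=.
  have /submxP[c ->] : (D <= A1 *m E)%MS by rewrite A1D.
  move: S2 S2A1 {S2H S2S1} => S2 S2A1.
  by rewrite !trmx_mul !mulmxA -(mulmxA S2) -(mulmxA S2) EGE mulmx1 S2A1 mul0mx.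
set C := (_ :&: _)%MS.
have CJ : C *m J = 0 by apply/eqP; rewrite -sub_kermx capmxSl.
have CA1 : C *m G *m (A1 *m E)^T = 0.
  have /submxP[c ->] : (A1 *m E <= D)%MS by rewrite A1D.
  have : (C <= orth G D)%MS by exact: capmxSr.
  by rewrite sub_orth trmx_mul mulmxA => /eqP->; rewrite mul0mx.
have yE : C *m invmx E *m E = C by rewrite mulmxKV.
move: (C *m invmx E) yE => y yE.
have y0 : y *m SH = 0 by apply/H0; rewrite yE.
have yA1 : y *m A1^T = 0.
  move: CA1; rewrite -yE trmx_mul !mulmxA -(mulmxA y) -(mulmxA y).
  by rewrite EGE mulmx1.
have yS2 : y *m S2 = y by rewrite /S2 !mulmxBr mulmx1 y0 yS1// !subr0.
by rewrite -[X in (X <= _)%MS]yE -yS2 -mulmxA submxMl.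
Qed.

(** An isometry that preserves a subspace maps each of its orthonormal bases to
    another one: rho is the orthogonal matrix of A in the basis E, and
    rho^T S rho is the projection onto the image under A of the subspace. *)
Lemma isometry_projection G (E A S : 'M[R]_n) :
  G^T = G -> E *m G *m E^T = 1%:M ->
  (forall v w, inner G (v *m A) (w *m A) = inner G v w) ->
  S^T = S -> S *m S = S -> (S *m E *m A :=: S *m E)%MS ->
  exists2 rho, rho *m E = E *m A & (S *m rho)^T *m (S *m rho) = S.
Proof.
move=> GT EGE isoA ST SS SEA.
have [uE uG EE] := orthonormal_basis_unit EGE.
exists (E *m A *m (G *m E^T)).
  by rewrite -mulmxA -(mulmxA G) EE mulmxV// mulmx1.
set rho := E *m A *m _.
have rhoE : rho *m E = E *m A.
  by rewrite /rho -mulmxA -(mulmxA G) EE mulmxV// mulmx1.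
have AGA : A *m G *m A^T = G.
  have entry (H : 'M[R]_n) i j : inner H 'e_i 'e_j = H i j.
    by rewrite /inner -rowE trmx_delta -colE !mxE.
  apply/matrixP => i j; rewrite -[RHS]entry -isoA -[LHS]entry.
  by rewrite /inner trmx_mul !mulmxA.
have rr : rho *m rho^T = 1%:M.
  have -> : rho^T = E *m (G *m A^T *m E^T).
    by rewrite /rho !trmx_mul trmxK GT !mulmxA.
  rewrite mulmxA rhoE -(mulmxA E) (mulmxA A) (mulmxA A) AGA.
  by rewrite mulmxA.
move: rho rhoE rr => rho rhoE rr.
have urho : row_full rho^T.
  by rewrite row_full_unit unitmx_tr; exact: (mulmx1_unit rr).1.
have rSr : rho^T *m S *m rho = S.
  apply: projection_unique => //.
  - by rewrite !trmx_mul trmxK ST mulmxA.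
  - rewrite !mulmxA -(mulmxA _ rho) rr mulmx1.
    by rewrite -(mulmxA _ S S) SS.
  rewrite -mulmxA; apply: eqmx_trans (eqmxMfull _ urho) _.
  have e : (S *m rho *m E :=: S *m E)%MS by rewrite -mulmxA rhoE mulmxA.
  by have := eqmxMr (invmx E) e; rewrite !mulmxK.
by rewrite trmx_mul ST mulmxA -(mulmxA _ S S) SS rSr.
Qed.

End EuclideanLinearAlgebra.

(** * Local orthonormal frames *)

Section OrthonormalFrames.
Variables (R : realType) (n : nat) (M : manifold R n).
Implicit Types (U : set M) (p q : M).

Lemma smooth_invsqrt_entry U (S : M -> 'M[R]_n) i : open U ->
  (forall q, U q -> 0 < S q i i) -> smooth_matrix U S ->
  smooth_matrix U (fun q => ((Num.sqrt (S q i i))^-1)%:M : 'M[R]_1).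
Proof.
move=> oU S0 sS c ac; have oI := open_chart_image c oU.
apply/(smooth_mxP _ oI) => a b k.
have -> : (fun u => (((Num.sqrt (S (cinv c u) i i))^-1)%:M : 'M[R]_1) a b)
  = fun u => (Num.sqrt ((S \o cinv c) u i i))^-1.
  by apply/funext => u; rewrite !ord1 mxE eqxx mulr1n.
apply: class_C_invsqrt => //; first by move=> u /cinv_img[_ Uu _]; exact: S0.
exact: ((smooth_mxP _ oI).1 (sS c ac) i i k).
Qed.

Lemma smooth_matrix_col k l m U (A : M -> 'M[R]_(k, m)) (B : M -> 'M[R]_(l, m)) :
  open U -> smooth_matrix U A -> smooth_matrix U B ->
  smooth_matrix U (fun q => col_mx (A q) (B q)).
Proof.
move=> oU sA sB c ac; have oI := open_chart_image c oU.
apply/(smooth_mxP _ oI) => i j; rewrite /comp; under eq_fun do rewrite mxE.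
case: (fintype.split i) => a; first exact: ((smooth_mxP _ oI).1 (sA c ac) a j).
exact: ((smooth_mxP _ oI).1 (sB c ac) a j).
Qed.

Lemma smooth_det_matrix k U (A : M -> 'M[R]_k) : open U ->
  smooth_matrix U A -> smooth_matrix U (fun q => (\det (A q))%:M : 'M[R]_1).
Proof.
move=> oU sA c ac; have oI := open_chart_image c oU.
apply/(smooth_mxP _ oI) => a b j.
have -> : (fun u => ((\det (A (cinv c u)))%:M : 'M[R]_1) a b)
  = fun u => \det ((A \o cinv c) u).
  by apply/funext => u; rewrite !ord1 mxE eqxx mulr1n.
exact: smooth_det oI (sA c ac) j.
Qed.

Lemma smooth_entry_continuous k l U (A : M -> 'M[R]_(k, l)) p i j : open U -> U p ->
  smooth_matrix U A -> {for p, continuous (fun q => A q i j)}.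
Proof.
move=> oU Up sA; apply: (@continuous_comp _ _ _ A (fun B : 'M[R]_(k, l) => B i j) p).
  exact: smooth_matrix_continuous sA.
exact: coord_continuous.
Qed.

Lemma open_nbhs_shrink (T : topologicalType) (U P : set T) x : open U -> U x ->
  (\near x, P x) -> exists W, [/\ open W, W x, W `<=` U & W `<=` P].
Proof.
move=> oU Ux Px; have : nbhs x (U `&` P).
  by apply: filterI => //; exact: open_nbhs_nbhs.
rewrite nbhsE => -[W [oW Wx] WU]; exists W; split=> // y Wy; by have [] := WU y Wy.
Qed.

(** Induction on the rank of S p.  When S p is nonzero it has a positive diagonal
    entry; near p, the corresponding row of S can be normalized to a unit vector
    a in the image of S, and S - a^T a is a projection of smaller rank. *)
Lemma smooth_projection_frame U p (S : M -> 'M[R]_n) : open U -> U p ->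
  smooth_matrix U S -> (forall q, U q -> (S q)^T = S q /\ S q *m S q = S q) ->
  exists (W : set M) (k : nat) (A : M -> 'M[R]_(k, n)),
    [/\ open W, W p, W `<=` U, smooth_matrix W A &
        forall q, W q -> A q *m (A q)^T = 1%:M /\ (A q)^T *m A q = S q].
Proof.
have [r] := ubnP (\rank (S p)); elim: r U S => // r IH U S rS oU Up sS pS.
have cS i := smooth_entry_continuous (i := i) (j := i) oU Up sS.
have [S0|S0] := eqVneq (S p) 0.
  (* Near p the matrix 1 - S is still invertible, and (1 - S) S = 0. *)
  have sd : smooth_matrix U (fun q => (\det (1%:M - S q))%:M : 'M[R]_1).
    by apply: smooth_det_matrix => //; apply: smooth_matrixB => //; exact: smooth_matrix_cst.
  have cd := smooth_entry_continuous (i := 0) (j := 0) oU Up sd.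
  have nz : ((\det (1%:M - S p))%:M : 'M[R]_1) 0 0 != 0.
    by rewrite S0 subr0 det1 mxE oner_eq0.
  have [W [oW Wp WU Wd]] := open_nbhs_shrink oU Up (cvgr_neq0 _ cd nz).
  exists W, 0%N, (fun=> 0); split=> // [|q Wq]; first exact: smooth_matrix_cst.
  split; first by rewrite mul0mx; apply/matrixP => -[].
  have [_ SS] := pS q (WU q Wq).
  have uS : 1%:M - S q \in unitmx.
    by rewrite unitmxE unitfE; have := Wd q Wq; rewrite mxE eqxx mulr1n.
  rewrite mulmx0; apply: (can_inj (mulmxK uS)).
  by rewrite mul0mx mulmxBr mulmx1 SS subrr.
have [i Si0] : exists i, S p i i != 0.
  apply/existsP; apply: contraNT S0; rewrite negb_exists => /forallP H.
  have [ST SS] := pS p Up.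
  apply/eqP/row_matrixP => i; rewrite row0; apply: sum_squares_eq0.
  rewrite projection_row// (eqP (negbNE (H i))); apply/matrixP => x y.
  by rewrite !mxE mul0rn.
have Sge0 q : U q -> 0 <= S q i i.
  move=> /pS[ST SS]; have /matrixP/(_ 0 0) := projection_row i ST SS.
  rewrite [RHS]mxE eqxx mulr1n => <-; rewrite mxE; apply: sumr_ge0 => k _.
  by rewrite [X in _ * X]mxE -expr2 sqr_ge0.
have Spos : 0 < S p i i by rewrite lt_def Si0 Sge0.
have [W [oW Wp WU WS]] := open_nbhs_shrink oU Up (cvgr_gt _ (cS i) _ Spos).
have sSW := smooth_matrix_le WU sS.
pose a q : 'rV[R]_n := ((Num.sqrt (S q i i))^-1)%:M *m row i (S q).
have sa : smooth_matrix W a.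
  apply: smooth_matrix_mul => //; first exact: smooth_invsqrt_entry.
  have -> : (fun q => row i (S q)) = (fun q => delta_mx 0 i *m S q).
    by apply/funext => q; rewrite rowE.
  by apply: smooth_matrix_mul => //; exact: smooth_matrix_cst.
have aa q : W q -> a q *m (a q)^T = 1%:M.
  move=> Wq; have [ST SS] := pS q (WU q Wq).
  rewrite /a !mul_scalar_mx linearZ/= -scalemxAl -scalemxAr scalerA projection_row//.
  rewrite scale_scalar_mx -invfM -expr2 sqr_sqrtr ?mulVf//; last exact/ltW/WS.
  by rewrite gt_eqF// WS.
have aS q : W q -> a q *m S q = a q.
  by move=> Wq; have [_ SS] := pS q (WU q Wq); rewrite /a -!mulmxA -row_mul SS.
have Sa q : W q -> S q *m (a q)^T = (a q)^T.
  by move=> Wq; have [ST _] := pS q (WU q Wq); rewrite -[in LHS]ST -trmx_mul aS.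
pose S' q := S q - (a q)^T *m a q.
have sS' : smooth_matrix W S'.
  apply: smooth_matrixB => //; apply: smooth_matrix_mul => //.
  exact: smooth_matrix_tr.
have aS' q : W q -> a q *m S' q = 0.
  by move=> Wq; rewrite mulmxBr aS// mulmxA aa// mul1mx subrr.
have pS' q : W q -> (S' q)^T = S' q /\ S' q *m S' q = S' q.
  move=> Wq; have [ST SS] := pS q (WU q Wq).
  split; first by rewrite /S' linearB/= ST trmx_mul trmxK.
  rewrite {1}/S' mulmxBl -mulmxA aS'// mulmx0 subr0 mulmxBr SS.
  by rewrite mulmxA Sa.
have rS' : (\rank (S' p) < r)%N.
  rewrite -ltnS; apply: leq_trans rS; rewrite ltnS.
  have sub : (S' p <= S p)%MS.
    by rewrite addmx_sub// eqmx_opp -(aS p Wp) mulmxA submxMl.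
  apply: rank_ltmx; rewrite /ltmx sub; apply/negP => /submxP[D SD].
  have : a p = 0.
    have [_ S'S'] := pS' p Wp.
    have aDS : a p *m D *m S' p = a p by rewrite -mulmxA -SD aS.
    by rewrite -aDS -S'S' mulmxA aDS aS'.
  move=> a0; have := aa p Wp; rewrite a0 mul0mx => /matrixP/(_ 0 0).
  by rewrite !mxE eqxx => /esym/eqP; rewrite oner_eq0.
have [W' [k [A [oW' W'p W'W sA AA]]]] := IH W S' rS' oW Wp sS' pS'.
exists W', (1 + k)%N, (fun q => col_mx (a q) (A q)); split=> //.
- by move=> q /W'W/WU.
- by apply: smooth_matrix_col => //; exact: smooth_matrix_le sa.
move=> q W'q; have [A1 A2] := AA q W'q; have Wq := W'W q W'q.
rewrite tr_col_mx; split; last by rewrite mul_row_col A2 /S' addrC subrK.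
have aA : a q *m (A q)^T = 0.
  have -> : (A q)^T = S' q *m (A q)^T by rewrite -A2 -mulmxA A1 mulmx1.
  by rewrite mulmxA aS'// mul0mx.
rewrite mul_col_row aa// A1 aA.
have -> : A q *m (a q)^T = 0 by rewrite -[LHS]trmxK trmx_mul trmxK aA trmx0.
by rewrite -scalar_mx_block.
Qed.
End OrthonormalFrames.

(** * Metrics and their Christoffel symbols in charts *)

Section Christoffel.
Variables (R : realType) (n : nat).
Implicit Types (G : 'rV[R]_n -> 'M[R]_n) (u v w : 'rV[R]_n).

Lemma innerDl (g : 'M[R]_n) a (x y z : 'rV[R]_n) :
  inner g (a *: x + y) z = a * inner g x z + inner g y z.
Proof. by rewrite /inner !mulmxDl -!scalemxAl mxE [X in X + _]mxE. Qed.

Lemma innerDr (g : 'M[R]_n) a (x y z : 'rV[R]_n) :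
  inner g z (a *: x + y) = a * inner g z x + inner g z y.
Proof. by rewrite /inner linearD linearZ/= mulmxDr -scalemxAr mxE [X in X + _]mxE. Qed.

Lemma innerDm (g h : 'M[R]_n) a (x y : 'rV[R]_n) :
  inner (a *: g + h) x y = a * inner g x y + inner h x y.
Proof.
rewrite /inner mulmxDr mulmxDl -scalemxAr -scalemxAl mxE.
by rewrite [X in X + _]mxE.
Qed.

Lemma christoffelP G u a v w w' : differentiable G u ->
  christoffel G u v (a *: w + w') = a *: christoffel G u v w + christoffel G u v w'.
Proof.
move=> dG; rewrite /christoffel scalemxAl -mulmxDl; congr (_ *m _).
have -> : 'D_(a *: w + w') G u = a *: 'D_w G u + 'D_w' G u.
  by rewrite !(deriveE _ dG) linearD linearZ.
move: (derive G u) => D.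
by apply/rowP => l; rewrite !mxE !innerDl !innerDr innerDm; ring.
Qed.

Lemma christoffel0r G u v : differentiable G u -> christoffel G u v 0 = 0.
Proof.
move=> dG; have := christoffelP (- 1) v 0 0 dG.
by rewrite scaleN1r oppr0 addr0 scaleN1r addrC subrr.
Qed.

End Christoffel.

Section LocalMetric.
Variables (R : realType) (n : nat) (M : manifold R n) (g : M -> 'M[R]_n).
Hypothesis rg : riemannian_metric g.
Implicit Types (c : chart R n M) (p q : M) (U : set M).

Lemma local_metric_sym c u : (local_metric c g u)^T = local_metric c g u.
Proof.
have [gT _ _] := rg; rewrite /local_metric.
move: (of_chart c (cinv c u)) => O.
by rewrite !trmx_mul trmxK gT mulmxA.
Qed.

Lemma diff_local_metric c q : atlas c -> cdom c q ->
  differentiable (local_metric c g) (cmap c q).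
Proof.
by move=> ac cq; have [_ _ sg] := rg; apply: smooth_diff (sg c ac) _; exists q.
Qed.

Lemma of_chart_id p : of_chart (chart_at p) p = 1%:M.
Proof. exact: to_chart_id. Qed.

Lemma local_metric_at p : local_metric (chart_at p) g (cmap (chart_at p) p) = g p.
Proof.
rewrite /local_metric cmapK; last exact: chart_at_dom.
by rewrite of_chart_id mul1mx trmx1 mulmx1.
Qed.

Lemma riemannian_unit p : g p \in unitmx.
Proof. by have [_ pg _] := rg; apply: posdef_unit => v; exact: pg. Qed.

Lemma local_field_at p (X : M -> 'rV[R]_n) :
  local_field (chart_at p) X (cmap (chart_at p) p) = X p.
Proof.
rewrite /local_field cmapK; last exact: chart_at_dom.
by rewrite to_chart_id mulmx1.
Qed.

Lemma diff_local_field p U (X : M -> 'rV[R]_n) : U p -> smooth_field U X ->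
  differentiable (local_field (chart_at p) X) (cmap (chart_at p) p).
Proof.
move=> Up sX; apply: smooth_diff (sX _ (chart_at_atlas p)) _.
by apply: img_cmap => //; exact: chart_at_dom.
Qed.

End LocalMetric.

(** * The second fundamental form as a tensor *)

Section SecondFundamentalForm.
Variables (R : realType) (n m : nat) (M : manifold R n) (N : manifold R m).
Variables (gM : M -> 'M[R]_n) (gN : N -> 'M[R]_m) (F : M -> N).
Hypotheses (rM : riemannian_metric gM) (rN : riemannian_metric gN).
Hypothesis sF : smooth_map F.
Implicit Types (p q : M) (U : set M) (X Y : M -> 'rV[R]_n).

Definition chart_jacobian p := jacobian (local_map F (chart_at p) (chart_at (F p))).

(** The second fundamental form as a bilinear form on T_pM, in coordinates:
    d^2 F (v, w) + Gamma^N (dF v, dF w) - dF (Gamma^M (v, w)). *)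
Definition hessian p (v w : 'rV[R]_n) : 'rV[R]_m :=
  w *m 'D_v (chart_jacobian p) (cmap (chart_at p) p)
  + christoffel (local_metric (chart_at (F p)) gN) (cmap (chart_at (F p)) (F p))
      (v *m differential F p) (w *m differential F p)
  - christoffel (local_metric (chart_at p) gM) (cmap (chart_at p) p) v w
      *m differential F p.

Lemma chart_jacobian_at p :
  chart_jacobian p (cmap (chart_at p) p) = differential F p.
Proof. by []. Qed.

Lemma open_chart_nbhs p (d := chart_at (F p)) :
  [/\ open (chart_image (chart_at p) (F @^-1` cdom d)),
      chart_image (chart_at p) (F @^-1` cdom d) (cmap (chart_at p) p) &
      smooth_on (chart_image (chart_at p) (F @^-1` cdom d))
        (local_map F (chart_at p) d)].
Proof.
split.
- by apply: open_chart_image; exact: open_preimage.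
- by apply: img_cmap; exact: chart_at_dom.
- by apply: smooth_local_map => //; exact: chart_at_atlas.
Qed.

Lemma diff_chart_jacobian p :
  differentiable (chart_jacobian p) (cmap (chart_at p) p).
Proof.
have [oI Ip sl] := open_chart_nbhs p.
exact: smooth_diff (smooth_jacobian oI sl) Ip.
Qed.

(** The expression differentiated by the pullback connection, computed in the
    chart at p. *)
Lemma near_pushforward p X :
  \forall u \near cmap (chart_at p) p,
    Defs.pushforward F X (cinv (chart_at p) u) *m to_chart (chart_at (F p)) (F (cinv (chart_at p) u))
    = local_field (chart_at p) X u *m chart_jacobian p u.
Proof.
have [oI Ip _] := open_chart_nbhs p.
apply: filterS (open_nbhs_nbhs (conj oI Ip)) => u /cinv_img[cu du uE].
by apply: local_pushforward => //; exact: chart_at_atlas.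
Qed.

Lemma pullback_pushforward p v X :
  differentiable (local_field (chart_at p) X) (cmap (chart_at p) p) ->
  pullback_connection gN F p v (Defs.pushforward F X)
  = 'D_v (local_field (chart_at p) X) (cmap (chart_at p) p) *m differential F p
    + X p *m 'D_v (chart_jacobian p) (cmap (chart_at p) p)
    + christoffel (local_metric (chart_at (F p)) gN) (cmap (chart_at (F p)) (F p))
       (v *m differential F p) (X p *m differential F p).
Proof.
move=> dX; rewrite /pullback_connection; congr (_ + _).
rewrite (near_eq_derive _ (near_pushforward p X)).
by rewrite (derive_mulmx _ dX (diff_chart_jacobian p)) local_field_at.
Qed.

(** The first derivatives of Y contribute the same term to both connections, so
    they cancel and only the values at p matter. *)
Lemma second_fundamental_formE p X Y :
  differentiable (local_field (chart_at p) Y) (cmap (chart_at p) p) ->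
  second_fundamental_form gM gN F X Y p = hessian p (X p) (Y p).
Proof.
move=> dY; rewrite /second_fundamental_form pullback_pushforward// /levi_civita.
rewrite mulmxDl /hessian opprD !addrA; congr (_ - _).
by rewrite addrC !addrA addNr add0r.
Qed.

Lemma hessianP p v a w w' :
  hessian p v (a *: w + w') = a *: hessian p v w + hessian p v w'.
Proof.
have [ap a0] := (chart_at_atlas p, chart_at_dom p).
have [aF F0] := (chart_at_atlas (F p), chart_at_dom (F p)).
rewrite /hessian mulmxDl -scalemxAl mulmxDl -scalemxAl.
rewrite !christoffelP; [|exact: diff_local_metric|exact: diff_local_metric].
rewrite mulmxDl -scalemxAl.
have collect (A A' B B' C C' : 'rV[R]_m) :
    a *: A + A' + (a *: B + B') - (a *: C + C') = a *: (A + B - C) + (A' + B' - C').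
  by apply/rowP => j; rewrite !mxE; ring.
exact: collect.
Qed.

(** The Christoffel symbols are symmetric and so are the second derivatives
    of F. *)
Lemma hessianC p v w : hessian p v w = hessian p w v.
Proof.
have [oI Ip sl] := open_chart_nbhs p.
have [ap a0] := (chart_at_atlas p, chart_at_dom p).
have [aF F0] := (chart_at_atlas (F p), chart_at_dom (F p)).
have dN := diff_local_metric rN aF F0; have dM := diff_local_metric rM ap a0.
have E1 : w *m 'D_v (chart_jacobian p) (cmap (chart_at p) p)
        = v *m 'D_w (chart_jacobian p) (cmap (chart_at p) p).
  exact: derive_jacobianC oI Ip sl.
rewrite /hessian E1 (christoffelC _ _ (local_metric_sym rN _) dN).
by rewrite (christoffelC _ _ (local_metric_sym rM _) dM).
Qed.

End SecondFundamentalForm.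

(** * The horizontal part of the second fundamental form *)

Section MetricConnections.
Variables (R : realType).

Lemma derive_inner (V : normedModType R) k (G : V -> 'M[R]_k) (x y : V -> 'rV[R]_k) u v :
  differentiable G u -> differentiable x u -> differentiable y u ->
  'D_v (fun t => inner (G t) (x t) (y t)) u
  = inner ('D_v G u) (x u) (y u)
    + (inner (G u) ('D_v x u) (y u) + inner (G u) (x u) ('D_v y u)).
Proof.
move=> dG dx dy; have dxG := diff_mulmx dx dG; have dyT := diff_trmx dy.
rewrite -(derive_entry v 0 0 (diff_mulmx dxG dyT)).
rewrite (derive_mulmx v dxG dyT) (derive_mulmx v dx dG) (derive_trmx v dy).
by rewrite /inner mulmxDl !mxE; ring.
Qed.

Lemma innerD2 k (g : 'M[R]_k) (a b c d x y : 'rV[R]_k) :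
  inner g (a + b) y + inner g x (c + d)
  = inner g b y + inner g x d + (inner g a y + inner g x c).
Proof. by rewrite /inner !mulmxDl linearD mulmxDr !mxE; ring. Qed.

Variables (n m : nat) (M : manifold R n) (N : manifold R m).
Variables (gM : M -> 'M[R]_n) (gN : N -> 'M[R]_m) (F : M -> N).
Hypotheses (rM : riemannian_metric gM) (rN : riemannian_metric gN).
Hypothesis sF : smooth_map F.
Implicit Types (p q : M) (U : set M) (X Y : M -> 'rV[R]_n).

(** The derivative of the coordinate metric is absorbed by the Christoffel
    symbols. *)
Lemma levi_civita_metric p v X Y :
  differentiable (local_field (chart_at p) X) (cmap (chart_at p) p) ->
  differentiable (local_field (chart_at p) Y) (cmap (chart_at p) p) ->
  'D_v (fun u => inner (local_metric (chart_at p) gM u)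
     (local_field (chart_at p) X u) (local_field (chart_at p) Y u)) (cmap (chart_at p) p)
  = inner (gM p) (levi_civita gM p v X) (Y p) + inner (gM p) (X p) (levi_civita gM p v Y).
Proof.
move=> dX dY; have [ap a0] := (chart_at_atlas p, chart_at_dom p).
have dG := diff_local_metric rM ap a0.
rewrite (derive_inner v dG dX dY) !local_field_at local_metric_at /levi_civita.
rewrite innerD2; congr (_ + _).
have uG : local_metric (chart_at p) gM (cmap (chart_at p) p) \in unitmx.
  by rewrite local_metric_at; exact: riemannian_unit.
by rewrite (christoffel_metric _ _ _ (local_metric_sym rM _) dG uG) local_metric_at.
Qed.

(** The metric of N along F is differentiated by the chain rule, in the
    direction dF v. *)
Lemma pullback_metric p v X Y :
  differentiable (local_field (chart_at p) X) (cmap (chart_at p) p) ->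
  differentiable (local_field (chart_at p) Y) (cmap (chart_at p) p) ->
  'D_v (fun u => inner ((local_metric (chart_at (F p)) gN \o
                          local_map F (chart_at p) (chart_at (F p))) u)
     (local_field (chart_at p) X u *m chart_jacobian F p u)
     (local_field (chart_at p) Y u *m chart_jacobian F p u)) (cmap (chart_at p) p)
  = inner (gN (F p)) (pullback_connection gN F p v (Defs.pushforward F X))
      (Y p *m differential F p)
  + inner (gN (F p)) (X p *m differential F p)
      (pullback_connection gN F p v (Defs.pushforward F Y)).
Proof.
move=> dX dY; have [ap a0] := (chart_at_atlas p, chart_at_dom p).
have [aF F0] := (chart_at_atlas (F p), chart_at_dom (F p)).
have dJ := diff_chart_jacobian sF p.
have dL := diff_local_map sF ap aF a0 F0.
have dG := diff_local_metric rN aF F0.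
have LE : local_map F (chart_at p) (chart_at (F p)) (cmap (chart_at p) p)
    = cmap (chart_at (F p)) (F p) by rewrite /local_map /comp (cmapK a0).
have dG' : differentiable (local_metric (chart_at (F p)) gN)
   (local_map F (chart_at p) (chart_at (F p)) (cmap (chart_at p) p)) by rewrite LE.
have dGL := differentiable_comp dL dG'.
have dXJ := diff_mulmx dX dJ; have dYJ := diff_mulmx dY dJ.
rewrite (derive_inner v dGL dXJ dYJ) (derive_comp_rV v dL dG').
rewrite (deriveEjacobian v dL) /comp LE.
have uG : local_metric (chart_at (F p)) gN (cmap (chart_at (F p)) (F p)) \in unitmx.
  by rewrite local_metric_at; exact: riemannian_unit.
rewrite (christoffel_metric _ _ _ (local_metric_sym rN _) dG uG) local_metric_at.
rewrite (pullback_pushforward gN sF v dX) (pullback_pushforward gN sF v dY).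
rewrite (derive_mulmx v dX dJ) (derive_mulmx v dY dJ) !local_field_at.
rewrite -[jacobian (local_map F (chart_at p) (chart_at (F p))) _]/(differential F p).
by rewrite !chart_jacobian_at [RHS]innerD2.
Qed.

Lemma near_inner_pushforward p X Y :
  \forall u \near cmap (chart_at p) p,
    inner ((local_metric (chart_at (F p)) gN \o
              local_map F (chart_at p) (chart_at (F p))) u)
     (local_field (chart_at p) X u *m chart_jacobian F p u)
     (local_field (chart_at p) Y u *m chart_jacobian F p u)
    = inner (gN (F (cinv (chart_at p) u)))
        (X (cinv (chart_at p) u) *m differential F (cinv (chart_at p) u))
        (Y (cinv (chart_at p) u) *m differential F (cinv (chart_at p) u)).
Proof.
have [oI Ip _] := open_chart_nbhs sF p.
have [ap aF] := (chart_at_atlas p, chart_at_atlas (F p)).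
apply: filterS (open_nbhs_nbhs (conj oI Ip)) => u /cinv_img[cu du uE].
rewrite -[local_field _ X _ *m _](local_pushforward sF X ap aF cu uE du).
rewrite -[local_field _ Y _ *m _](local_pushforward sF Y ap aF cu uE du).
have -> : (local_metric (chart_at (F p)) gN \o local_map F (chart_at p) (chart_at (F p))) u
  = of_chart (chart_at (F p)) (F (cinv (chart_at p) u)) *m gN (F (cinv (chart_at p) u))
    *m (of_chart (chart_at (F p)) (F (cinv (chart_at p) u)))^T.
  by rewrite /comp /local_metric /local_map /comp (cmapK du).
have := to_of_chart aF du; rewrite /inner.
move: (to_chart (chart_at (F p)) _) (of_chart (chart_at (F p)) _) => T O TO.
by rewrite gram_change_basis.
Qed.

Lemma near_inner p X Y :
  \forall u \near cmap (chart_at p) p,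
    inner (local_metric (chart_at p) gM u)
     (local_field (chart_at p) X u) (local_field (chart_at p) Y u)
    = inner (gM (cinv (chart_at p) u)) (X (cinv (chart_at p) u)) (Y (cinv (chart_at p) u)).
Proof.
have ap := chart_at_atlas p.
have : \forall u \near cmap (chart_at p) p, chart_image (chart_at p) setT u.
  apply: open_nbhs_nbhs; split; first by apply: open_chart_image; exact: openT.
  by apply: img_cmap => //; exact: chart_at_dom.
apply: filterS => u /cinv_img[cu _ _].
by rewrite /inner (local_gram gM X Y ap cu : local_field _ X u *m _ *m (local_field _ Y u)^T = _).
Qed.

(** Differentiating gN (dF X, dF Y) = gM (X, Y), an identity between horizontal
    fields, in the direction v shows that gN (nabla_v dF X, dF Y)
    - gM (nabla_v X, Y) is skew in X, Y.  Since Y is horizontal,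
    gM (nabla_v X, Y) = gN (dF (nabla_v X), dF Y), so that the skew expression
    is gN ((nabla dF)(v, X), dF Y). *)
Lemma hessian_skew p v X Y U : open U -> U p ->
  riemannian_map gM gN F ->
  differentiable (local_field (chart_at p) X) (cmap (chart_at p) p) ->
  differentiable (local_field (chart_at p) Y) (cmap (chart_at p) p) ->
  (forall q, U q -> (X q <= horizontal gM F q)%MS) ->
  (forall q, U q -> (Y q <= horizontal gM F q)%MS) ->
  inner (gN (F p)) (hessian gM gN F p v (X p)) (Y p *m differential F p)
  = - inner (gN (F p)) (hessian gM gN F p v (Y p)) (X p *m differential F p).
Proof.
move=> oU Up [_ iso] dX dY hX hY.
have [gNT _ _] := rN.
have [gMT pM _] := rM.
have H : 'D_v (fun u => inner (local_metric (chart_at p) gM u)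
     (local_field (chart_at p) X u) (local_field (chart_at p) Y u)) (cmap (chart_at p) p)
  = 'D_v (fun u => inner ((local_metric (chart_at (F p)) gN \o
                          local_map F (chart_at p) (chart_at (F p))) u)
     (local_field (chart_at p) X u *m chart_jacobian F p u)
     (local_field (chart_at p) Y u *m chart_jacobian F p u)) (cmap (chart_at p) p).
  apply: near_eq_derive.
  have nU : \forall u \near cmap (chart_at p) p, chart_image (chart_at p) U u.
    apply: open_nbhs_nbhs; split; first exact: open_chart_image.
    by apply: img_cmap => //; exact: chart_at_dom.
  apply: filterS (filterI nU (filterI (near_inner p X Y) (near_inner_pushforward p X Y))).
  move=> u [/cinv_img[_ Uu _] [E1 E2]].
  apply: etrans E1 (etrans _ (esym E2)).
  exact: (esym (iso _ _ _ (hX _ Uu) (hY _ Uu))).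
rewrite (levi_civita_metric v dX dY) (pullback_metric v dX dY) in H.
have EX : hessian gM gN F p v (X p) = pullback_connection gN F p v (Defs.pushforward F X)
     - levi_civita gM p v X *m differential F p.
  by rewrite -(second_fundamental_formE gM gN sF (fun=> v) dX).
have EY : hessian gM gN F p v (Y p) = pullback_connection gN F p v (Defs.pushforward F Y)
     - levi_civita gM p v Y *m differential F p.
  by rewrite -(second_fundamental_formE gM gN sF (fun=> v) dY).
(* It suffices that one of the two vectors is horizontal, because the vertical
   part of the other one is killed by dF and is orthogonal to the first. *)
have hor z (w : 'rV[R]_n) : (w <= horizontal gM F p)%MS ->
    inner (gN (F p)) (z *m differential F p) (w *m differential F p) = inner (gM p) z w.
  move=> hw; have /sub_addsmxP[[a b]] : (z <= ker_diff F p + horizontal gM F p)%MS.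
    by apply: submx_trans (addsmx_orth _ (pM p)); exact: submx1.
  move=> /= ->; rewrite mulmxDl -(mulmxA a) mulmx_ker mulmx0 add0r.
  have aw0 : inner (gM p) (a *m ker_diff F p) w = 0.
    move: hw; rewrite /horizontal sub_orth => /eqP wk.
    by rewrite innerC// /inner trmx_mul mulmxA wk mul0mx mxE.
  by rewrite (iso _ _ _ (submxMl _ _) hw) -[a *m _]scale1r innerDl mul1r aw0 add0r.
move: (hor (levi_civita gM p v X) _ (hY p Up)) (hor (levi_civita gM p v Y) _ (hX p Up)).
rewrite EX EY => h1 h2.
have sub g (a b c : 'rV[R]_m) : inner g (a - b) c = inner g a c - inner g b c.
  by rewrite -scaleN1r addrC innerDl mulN1r addrC.
rewrite !sub h1 h2 (innerC (X p) (levi_civita gM p v Y) (gMT p)) in H *.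
rewrite (innerC (X p *m _) _ (gNT _)) in H.
by apply/eqP; rewrite -subr_eq0 opprK addrACA -H -opprD subrr.
Qed.

End MetricConnections.

(** * Brackets of sections of an integrable distribution *)

Section Integrability.
Variables (R : realType) (n : nat) (M : manifold R n).
Implicit Types (p q : M) (U : set M) (X Y : M -> 'rV[R]_n) (D : M -> 'M[R]_n).

Lemma tangent_coordinates k l (A : 'M[R]_(k, n)) (x : 'M[R]_(l, n)) : row_free A ->
  (x <= A)%MS -> x *m A^T *m invmx (A *m A^T) *m A = x.
Proof.
move=> fA /submxP[a ->]; have [uA _] := rowspace_projection fA.
by rewrite -(mulmxA a) mulmxK.
Qed.

(** Along an integral manifold f of D, fields tangent to D lift to fields on the
    parameter domain: X o f = X' df.  Differentiating Y o f = Y' df along X'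
    gives D_X Y = (D_X' Y') df + d^2 f (X', Y').  The last term is symmetric in
    X and Y, so the bracket lies in the image of df, which is D. *)
Lemma integrable_bracket D U p X Y : integrable_distribution D ->
  open U -> U p -> smooth_field U X -> smooth_field U Y ->
  (forall q, U q -> (X q <= D q)%MS) -> (forall q, U q -> (Y q <= D q)%MS) ->
  ('D_(X p) (local_field (chart_at p) Y) (cmap (chart_at p) p)
   - 'D_(Y p) (local_field (chart_at p) X) (cmap (chart_at p) p) <= D p)%MS.
Proof.
move=> iD oU + sX sY XD YD.
have [k [V [f [v0 [[oV Vv0] <- cf sf Df]]]]] := iD p => Up.
set c := chart_at (f v0).
have [ac c0] : atlas c /\ cdom c (f v0).
  by split; [exact: chart_at_atlas|exact: chart_at_dom].
have nW : \forall v \near v0, cdom c (f v) /\ U (f v).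
  have : \forall q \near f v0, cdom c q /\ U q.
    by apply: filterI; apply: open_nbhs_nbhs; split=> //; exact: cdom_open.
  exact: cf.
have [W [oW Wv0 WV WcU]] := open_nbhs_shrink oV Vv0 nW.
pose phi := cmap c \o f.
have sphi : smooth_on W phi.
  by apply: smooth_le (sf c ac) => v Wv; split; [exact: WV|exact: (WcU v Wv).1].
have sJ := smooth_jacobian oW sphi.
pose df v := jacobian (cmap (chart_at (f v)) \o f) v.
have Jphi v : W v -> jacobian phi v = df v *m to_chart c (f v).
  move=> Wv; have [cv Uv] := WcU v Wv.
  have [av dv] := (chart_at_atlas (f v), chart_at_dom (f v)).
  have d1 : differentiable (cmap (chart_at (f v)) \o f) v.
    by apply: smooth_diff (sf _ av) _; split=> //; exact: WV.
  have d2 := diff_transition av ac dv cv.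
  by have [] := jacobian_through (cf v (WV v Wv)) dv d1 d2.
have fJ v : W v -> row_free (jacobian phi v).
  move=> Wv; have [cv _] := WcU v Wv; rewrite (Jphi v Wv).
  have [fdf _] := Df v (WV v Wv).
  rewrite /row_free mxrankMfree ?row_free_unit//.
  exact: (mulmx1_unit (to_of_chart ac cv)).1.
have inJ (Z : M -> 'rV[R]_n) v : (forall q, U q -> (Z q <= D q)%MS) -> W v ->
    (local_field c Z (phi v) <= jacobian phi v)%MS.
  move=> ZD Wv; have [cv Uv] := WcU v Wv.
  rewrite (Jphi v Wv) /local_field /phi /comp (cmapK cv).
  apply: submxMr; have [_ ->] := Df v (WV v Wv); exact: ZD.
(* The right inverse J^T (J J^T)^-1 of the Jacobian gives lifts that are
   visibly smooth. *)
pose lift (Z : M -> 'rV[R]_n) v := local_field c Z (phi v) *m (jacobian phi v)^T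
   *m invmx (jacobian phi v *m (jacobian phi v)^T).
have liftE Z v : (forall q, U q -> (Z q <= D q)%MS) -> W v ->
    lift Z v *m jacobian phi v = local_field c Z (phi v).
  by move=> ZD Wv; apply: tangent_coordinates; [exact: fJ|exact: inJ].
have slift Z : smooth_field U Z -> smooth_on W (lift Z).
  move=> sZ; have sJT := smooth_trmx oW sJ.
  apply: (smooth_mulmx oW); last first.
    apply: (smooth_invmx oW); last exact: (smooth_mulmx oW sJ sJT).
    by move=> v Wv; exact: (rowspace_projection (fJ v Wv)).1.
  apply: (smooth_mulmx oW) => //.
  apply: (smooth_comp oW (open_chart_image c oU) _ sphi (sZ c ac)) => v Wv.
  by have [cv Uv] := WcU v Wv; exact: img_cmap.
have phi0 : phi v0 = cmap c (f v0) by [].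
have dphi := smooth_diff sphi Wv0.
have dJ := smooth_diff sJ Wv0.
have key Z Z' : smooth_field U Z -> smooth_field U Z' ->
    (forall q, U q -> (Z q <= D q)%MS) -> (forall q, U q -> (Z' q <= D q)%MS) ->
    'D_(Z (f v0)) (local_field c Z') (cmap c (f v0))
    = 'D_(lift Z v0) (lift Z') v0 *m jacobian phi v0
      + lift Z' v0 *m 'D_(lift Z v0) (jacobian phi) v0.
  move=> sZ sZ' ZD Z'D.
  rewrite -(derive_mulmx _ (smooth_diff (slift _ sZ') Wv0) dJ).
  have ne : {near v0, (fun v => lift Z' v *m jacobian phi v) =1 local_field c Z' \o phi}.
    by apply: (open_near_eq oW Wv0) => v Wv; exact: liftE.
  rewrite (near_eq_derive _ ne).
  have dZ' : differentiable (local_field c Z') (phi v0) by exact: diff_local_field sZ'.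
  rewrite (derive_comp_rV _ dphi dZ') (deriveEjacobian _ dphi) (liftE Z v0 ZD Wv0).
  by rewrite phi0 local_field_at.
rewrite (key X Y)// (key Y X)//.
rewrite (derive_jacobianC (lift Y v0) (lift X v0) oW Wv0 sphi).
have cancel_sum (a b : 'rV[R]_k) (B : 'M[R]_(k, n)) (z : 'rV[R]_n) :
    a *m B + z - (b *m B + z) = (a - b) *m B.
  by rewrite opprD addrACA subrr addr0 mulmxBl.
rewrite cancel_sum; apply: submx_trans (submxMl _ _) _.
rewrite (Jphi v0 Wv0) to_chart_id mulmx1.
by have [_ ->] := Df v0 Vv0.
Qed.

Lemma smooth_field_endo U X (A : M -> 'M[R]_n) : open U -> smooth_endo A ->
  smooth_field U X -> smooth_field U (fun q => X q *m A q).
Proof.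
move=> oU sA sX c ac; have oI := open_chart_image c oU.
have sA' : smooth_on (chart_image c U) (local_endo c A).
  by apply: smooth_le (sA c ac); rewrite -chart_imageT; exact: chart_image_le.
have H := smooth_mulmx oI (sX c ac) sA'.
apply: (smooth_eq oI _ H) => u /cinv_img[cu _ _].
rewrite /local_field /local_endo; have := to_of_chart ac cu.
move: (to_chart c _) (of_chart c _) => T O TO.
by rewrite !mulmxA -(mulmxA (X _) T O) TO mulmx1.
Qed.

(** The Levi-Civita connection is torsion-free. *)
Lemma levi_civita_bracket (g : M -> 'M[R]_n) p X Y : riemannian_metric g ->
  levi_civita g p (X p) Y - levi_civita g p (Y p) X
  = 'D_(X p) (local_field (chart_at p) Y) (cmap (chart_at p) p)
   - 'D_(Y p) (local_field (chart_at p) X) (cmap (chart_at p) p).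
Proof.
move=> rg; rewrite /levi_civita.
have dG := diff_local_metric rg (chart_at_atlas p) (chart_at_dom p).
rewrite (christoffelC (Y p) (X p) (local_metric_sym rg _) dG).
have cancel_sum (a b z : 'rV[R]_n) : a + z - (b + z) = a - b.
  by rewrite opprD addrACA subrr addr0.
exact: cancel_sum.
Qed.

End Integrability.

(** * The second fundamental form on an invariant distribution *)

Section VerticalPart.
Variables (R : realType) (n m : nat) (M : manifold R n) (N : manifold R m).
Variables (gM : M -> 'M[R]_n) (gN : N -> 'M[R]_m) (F : M -> N).
Hypotheses (rM : riemannian_metric gM) (rN : riemannian_metric gN).
Hypothesis sF : smooth_map F.
Implicit Types (p q : M) (U : set M) (X Y : M -> 'rV[R]_n).

(** The push-forward of X is the zero section, and so is its derivative. *)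
Lemma hessian_vertical U p v X : open U -> U p -> smooth_field U X ->
  (forall q, U q -> (X q <= ker_diff F q)%MS) ->
  hessian gM gN F p v (X p) = - levi_civita gM p v X *m differential F p.
Proof.
move=> oU Up sX Xker.
have X0 q : U q -> X q *m differential F q = 0.
  by move=> /Xker; rewrite sub_kermx => /eqP.
have dX := diff_local_field Up sX.
rewrite -(second_fundamental_formE gM gN sF (fun=> v) dX) /second_fundamental_form.
rewrite mulNmx -[RHS]add0r; congr (_ + _); rewrite /pullback_connection.
have dG := diff_local_metric rN (chart_at_atlas (F p)) (chart_at_dom (F p)).
rewrite {2}/Defs.pushforward (X0 p Up) (christoffel0r _ dG) addr0.
have ne : {near cmap (chart_at p) p, (fun u => Defs.pushforward F X (cinv (chart_at p) u)
    *m to_chart (chart_at (F p)) (F (cinv (chart_at p) u))) =1 cst 0}.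
  have nU : \forall u \near cmap (chart_at p) p, chart_image (chart_at p) U u.
    apply: open_nbhs_nbhs; split; first exact: open_chart_image.
    by apply: img_cmap => //; exact: chart_at_dom.
  apply: filterS nU => u /cinv_img[_ Uu _].
  by rewrite /Defs.pushforward (X0 _ Uu) mul0mx.
by rewrite (near_eq_derive _ ne) derive_cst.
Qed.

(** Write Y = A X.  As A is parallel, (nabla dF)(Y, Y) = - dF (A nabla_Y X), and
    nabla_Y X = nabla_X Y + [Y, X], where A [Y, X] is in D, hence in ker dF.
    What remains is - dF (A nabla_X Y) = - dF (A^2 nabla_X X)
    = dF (nabla_X X) = - (nabla dF)(X, X). *)
Lemma hessian_complex D (A : M -> 'M[R]_n) U p X :
  smooth_endo A -> parallel gM A -> (forall q, A q *m A q = - 1%:M) ->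
  integrable_distribution D -> (forall q, (D q <= ker_diff F q)%MS) ->
  (forall q, (D q *m A q :=: D q)%MS) ->
  open U -> U p -> smooth_field U X -> (forall q, U q -> (X q <= D q)%MS) ->
  hessian gM gN F p (X p *m A p) (X p *m A p) = - hessian gM gN F p (X p) (X p).
Proof.
move=> sA pA A2 iD Dker DA oU Up sX XD.
pose Y q := X q *m A q.
have sY : smooth_field U Y by exact: smooth_field_endo.
have YD q : U q -> (Y q <= D q)%MS.
  by move=> Uq; rewrite -(DA q); apply: submxMr; exact: XD.
have ker (Z : M -> 'rV[R]_n) : (forall q, U q -> (Z q <= D q)%MS) ->
    forall q, U q -> (Z q <= ker_diff F q)%MS.
  by move=> ZD q Uq; exact: submx_trans (ZD q Uq) (Dker q).
rewrite -/(Y p) (hessian_vertical (Y p) oU Up sY (ker _ YD)).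
rewrite (hessian_vertical (X p) oU Up sX (ker _ XD)).
have PY v : levi_civita gM p v Y = levi_civita gM p v X *m A p.
  by apply: (pA p U) => //; split.
have := integrable_bracket iD oU Up sY sX YD XD.
rewrite -(levi_civita_bracket p Y X rM); set b := _ - _ => bD.
have bA : b *m A p *m differential F p = 0.
  apply/eqP; rewrite -sub_kermx; apply: submx_trans (Dker p).
  by rewrite -(DA p); exact: submxMr.
have -> : levi_civita gM p (Y p) Y = b *m A p - levi_civita gM p (X p) X.
  rewrite PY; have -> : levi_civita gM p (Y p) X = b + levi_civita gM p (X p) Y.
    by rewrite /b subrK.
  by rewrite mulmxDl PY -mulmxA A2 mulmxN mulmx1.
by rewrite opprB mulmxBl bA subr0 mulNmx opprK.
Qed.

End VerticalPart.

(** * Traces over subspaces *)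

Section Traces.
Variables (R : realType) (n m : nat).

(** For orthonormal rows of A in the orthonormal basis E, the sum on the left is
    the trace of h over the subspace that they span, and A^T A is the
    projection onto it; the trace depends on the subspace only. *)
Lemma trace_quadratic (h : 'rV[R]_n -> 'rV[R]_n -> 'rV[R]_m) (E : 'M[R]_n) :
  (forall v a w w', h v (a *: w + w') = a *: h v w + h v w') ->
  (forall v w, h v w = h w v) ->
  forall l, exists b : 'M[R]_n, forall k (A : 'M[R]_(k, n)),
    (\sum_i h (row i (A *m E)) (row i (A *m E))) 0 l = \tr (b *m (A^T *m A)).
Proof.
move=> hlin hC l.
have h0 v : h v 0 = 0.
  by have := hlin v (- 1) 0 0; rewrite scaleN1r oppr0 addr0 scaleN1r addrC subrr.
have hsum v (c : 'I_n -> R) (w : 'I_n -> 'rV[R]_n) :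
    h v (\sum_j c j *: w j) = \sum_j c j *: h v (w j).
  elim: (index_enum _) => [|j r IH]; first by rewrite !big_nil h0.
  by rewrite !big_cons hlin IH.
have rowE k (A : 'M[R]_(k, n)) i : row i (A *m E) = \sum_j A i j *: row j E.
  by rewrite row_mul mulmx_sum_row; apply: eq_bigr => j _; rewrite mxE.
exists (\matrix_(i, j) h (row i E) (row j E) 0 l) => k A.
set b := \matrix_(i, j) _.
rewrite mulmxA mxtrace_mulC mulmxA /mxtrace summxE; apply: eq_bigr => i _.
rewrite rowE hsum summxE mxE; apply: eq_bigr => j _.
rewrite mxE [A^T _ _]mxE mulrC; congr (_ * _).
rewrite hC hsum summxE mxE; apply: eq_bigr => j' _.
by rewrite mxE [b _ _]mxE hC.
Qed.

Lemma orthonormal_rows_proj k (A : 'M[R]_(k, n)) :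
  A *m A^T = 1%:M -> (A^T *m A :=: A)%MS.
Proof.
move=> AA; apply/eqmxP/andP; split; first exact: submxMl.
by apply/submxP; exists A; rewrite mulmxA AA mul1mx.
Qed.

End Traces.

(** * The trace over the horizontal distribution *)

Section HorizontalPart.
Variables (R : realType) (n m : nat) (M : manifold R n) (N : manifold R m).
Variables (gM : M -> 'M[R]_n) (gN : N -> 'M[R]_m) (F : M -> N).
Hypotheses (rM : riemannian_metric gM) (rN : riemannian_metric gN).
Hypothesis rF : riemannian_map gM gN F.
Implicit Types (p q : M) (U : set M).

Lemma normal_proj_range p k (x : 'M[R]_(k, n)) :
  x *m differential F p *m normal_proj gN F p = 0.
Proof.
have [_ pN _] := rN; rewrite /normal_proj.
apply: proj_mx_0; first by rewrite capmxC; exact: capmx_orth (pN _).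
by rewrite genmxE submxMl.
Qed.

Lemma normal_proj_normal p (x : 'rV[R]_m) :
  x *m gN (F p) *m (differential F p)^T = 0 -> x *m normal_proj gN F p = x.
Proof.
have [_ pN _] := rN => x0; rewrite /normal_proj.
apply: proj_mx_id; first by rewrite capmxC; exact: capmx_orth (pN _).
have /submxP[a ->] : (range_diff F p <= differential F p)%MS by rewrite genmxE.
by rewrite sub_orth trmx_mul mulmxA x0 mul0mx.
Qed.

(** The trilinear form T (X, Y, Z) = gN ((nabla dF)(X, Y), dF Z) on horizontal
    vectors is symmetric in X, Y and skew in Y, Z, which makes it zero.  So the
    trace is normal to range dF, and the normal component of the trace is l times
    the mean curvature vector. *)
Lemma horizontal_trace U p l (H : M -> 'M[R]_(l, n)) :
  mean_curvature_zero gM gN F -> open U -> U p ->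
  orthonormal_frame gM U (horizontal gM F) H ->
  \sum_i hessian gM gN F p (row i (H p)) (row i (H p)) = 0.
Proof.
move=> mc oU Up oH; have [sH HH] := oH; have [sF iso] := rF.
have [gNT pN _] := rN; have [_ pM _] := rM.
have dH i : differentiable (local_field (chart_at p) (frame_field H i)) (cmap (chart_at p) p).
  exact: diff_local_field Up (sH i).
have hH i q : U q -> (frame_field H i q <= horizontal gM F q)%MS.
  by move=> Uq; have [_ <-] := HH q Uq; exact: row_sub.
pose T k i j := inner (gN (F p)) (hessian gM gN F p (row k (H p)) (row i (H p)))
   (row j (H p) *m differential F p).
have Tsym k i j : T k i j = T i k j by rewrite /T hessianC.
have Tskew k i j : T k i j = - T k j i.
  exact: (hessian_skew rM rN sF (row k (H p)) oU Up rF (dH i) (dH j) (hH i) (hH j)).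
have T0 k i j : T k i j = 0.
  have : T k i j = - T k i j.
    by rewrite {1}Tskew Tsym Tskew opprK Tsym Tskew Tsym.
  by move=> /eqP; rewrite -addr_eq0 -mulr2n mulrn_eq0 => /eqP.
set tau := \sum_i _.
have tau_normal : tau *m gN (F p) *m (differential F p)^T = 0.
  have tH : tau *m gN (F p) *m (H p *m differential F p)^T = 0.
    apply/rowP => j; rewrite [RHS]mxE.
    have -> : (tau *m gN (F p) *m (H p *m differential F p)^T) 0 j
       = \sum_i T i i j.
      rewrite /tau !mulmx_suml summxE; apply: eq_bigr => i _.
      rewrite /T /inner -row_mul.
      rewrite mxE [RHS]mxE; apply: eq_bigr => a _; congr (_ * _).
      by rewrite [LHS]mxE [RHS]mxE [RHS]mxE.
    by rewrite big1.
  have /sub_addsmxP[[a b] /= E1] : (1%:M <= ker_diff F p + horizontal gM F p)%MS.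
    exact: addsmx_orth (pM p).
  have /submxP[c bH] : (b *m horizontal gM F p <= H p)%MS.
    by have [_ ->] := HH p Up; exact: submxMl.
  rewrite -[differential F p]mul1mx E1 bH mulmxDl -(mulmxA a) mulmx_ker mulmx0 add0r.
  by rewrite -(mulmxA c) trmx_mul mulmxA tH mul0mx.
rewrite -(normal_proj_normal tau_normal).
(* The mean curvature carries the factor 1/l, which is 0 for l = 0. *)
have [l0|lpos] := posnP l.
  by rewrite /tau big1 ?mul0mx// => -[i li]; exfalso; rewrite l0 in li.
have := mc p U l H (conj oU Up) oH; rewrite /mean_curvature => /eqP.
rewrite scaler_eq0 invr_eq0 pnatr_eq0 eqn0Ngt lpos /= => /eqP <-.
rewrite /tau mulmx_suml; apply: eq_bigr => i _.
rewrite -[row i (H p)]/(frame_field H i p).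
rewrite -(second_fundamental_formE gM gN sF (frame_field H i) (dH i)).
by rewrite /second_fundamental_form mulmxBl normal_proj_range subr0.
Qed.

End HorizontalPart.

(** * Harmonicity *)

Section Harmonicity.
Variables (R : realType) (n m : nat) (M : manifold R n) (N : manifold R m).
Variables (gM : M -> 'M[R]_n) (gN : N -> 'M[R]_m) (F : M -> N).
Hypotheses (rM : riemannian_metric gM) (rN : riemannian_metric gN).
Hypothesis rF : riemannian_map gM gN F.
Implicit Types (p q : M) (U : set M).

Lemma sum_second_fundamental_form U p k (E : M -> 'M[R]_(k, n)) : U p ->
  (forall i, smooth_field U (frame_field E i)) ->
  \sum_i second_fundamental_form gM gN F (frame_field E i) (frame_field E i) p
  = \sum_i hessian gM gN F p (row i (E p)) (row i (E p)).
Proof.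
move=> Up sE; apply: eq_bigr => i _; have [sF _] := rF.
by rewrite (second_fundamental_formE gM gN sF _ (diff_local_field Up (sE i))).
Qed.

(** The trace over T_pM is the sum of the traces over the horizontal space, D and
    the complement of D in ker dF.  All three are read off from projection
    matrices SH, S1 and S2 in the given orthonormal frame E; smoothness of these
    matrices provides the local orthonormal frames for which the hypotheses on
    the first and the last of these spaces are stated. *)
Lemma harmonic_from_complex_structure (A D : M -> 'M[R]_n) :
  mean_curvature_zero gM gN F ->
  smooth_endo A -> parallel gM A -> (forall p, A p *m A p = - 1%:M) ->
  (forall p v w, inner (gM p) (v *m A p) (w *m A p) = inner (gM p) v w) ->
  is_distribution D -> (forall p, (D p <= ker_diff F p)%MS) ->
  (forall p, (D p *m A p :=: D p)%MS) -> integrable_distribution D ->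
  trace_zero_on gM gN F (ker_complement gM F D) ->
  harmonic_map gM gN F.
Proof.
move=> mc sA pA A2 isoA dD Dker DA iD tr0 p U k E [oU Up] [sE frE].
have [sF iso] := rF; have [gMT pM _] := rM; have [gNT pN _] := rN.
(* A frame of the whole tangent bundle consists of n vector fields. *)
have kn : k = n.
  have [EGE E1M] := frE p Up.
  have rkE : \rank (E p) = n by rewrite E1M mxrank1.
  apply/eqP; rewrite -[X in _ == X]rkE eqn_leq rank_leq_row andbT.
  by rewrite -[X in (X <= _)%N](mxrank1 R) -EGE -mulmxA mxrankM_maxl.
subst k.
have sEf : smooth_frame U E by apply/smooth_frameP.
have [W0 [k1 [E1 [[oW0 W0p] sE1 frE1]]]] := dD p.
pose W := U `&` W0; have oW : open W by exact: openI.
have Wp : W p by [].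
have WU : W `<=` U by move=> q [].
have sE1f : smooth_frame W E1.
  by apply: (smooth_frame_le (U := W0)); [move=> q []|apply/smooth_frameP].
have sEW := smooth_frame_le WU sEf.
pose SH q := E q *m differential F q *m gN (F q) *m (E q *m differential F q)^T.
(* Components in the frame E of the local frame E1 of D. *)
pose A1 q := E1 q *m gM q *m (E q)^T.
pose S1 q := (A1 q)^T *m invmx (A1 q *m (A1 q)^T) *m A1 q.
pose S2 q := 1%:M - SH q - S1 q.
have uE q : U q -> [/\ E q \in unitmx, gM q \in unitmx & (E q)^T *m E q = invmx (gM q)].
  by move=> Uq; apply: orthonormal_basis_unit; exact: (frE q Uq).1.
have SHP q : U q -> [/\ (SH q)^T = SH q, SH q *m SH q = SH q,
    (SH q *m E q :=: horizontal gM F q)%MS &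
    forall k (x : 'M[R]_(k, n)), x *m SH q = 0 <-> x *m E q *m differential F q = 0].
  by move=> Uq; apply: horizontal_projection => //;
    [exact: pM|exact: (frE q Uq).1|exact: iso].
have A1E q : W q -> A1 q *m E q = E1 q.
  move=> [Uq _]; have [_ uG EE] := uE q Uq.
  by rewrite /A1 -mulmxA EE mulmxK.
have fA1 q : W q -> row_free (A1 q).
  move=> Wq; have [fE1 _] := frE1 q Wq.2; have [uEq _ _] := uE q Wq.1.
  by move: fE1; rewrite -(A1E q Wq) /row_free mxrankMfree// row_free_unit.
have S1P q : W q -> [/\ (S1 q)^T = S1 q, S1 q *m S1 q = S1 q,
    (S1 q :=: A1 q)%MS & A1 q *m S1 q = A1 q].
  by move=> Wq; exact: (rowspace_projection (fA1 q Wq)).2.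
have S1D q : W q -> (S1 q *m E q :=: D q)%MS.
  move=> Wq; have [_ _ S1A _] := S1P q Wq; have [_ E1D] := frE1 q Wq.2.
  by apply: eqmx_trans (eqmxMr _ S1A) _; rewrite A1E.
have S2P q : W q -> [/\ (S2 q)^T = S2 q, S2 q *m S2 q = S2 q &
    (S2 q *m E q :=: ker_complement gM F D q)%MS].
  move=> Wq; have [SHT SHSH _ H0] := SHP q Wq.1.
  apply: (complement_projection _ SHT SHSH H0 (fA1 q Wq)) => //.
    exact: (frE q Wq.1).1.
  by rewrite A1E//; exact: (frE1 q Wq.2).2.
have sSH : smooth_matrix U SH by exact: smooth_pushforward_gram.
have sA1 : smooth_matrix W A1 by exact: smooth_gram.
have sS1 : smooth_matrix W S1.
  apply: smooth_matrix_mul => //; apply: smooth_matrix_mul => //.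
    exact: smooth_matrix_tr.
  apply: smooth_matrix_inv => //; last first.
    by apply: smooth_matrix_mul => //; exact: smooth_matrix_tr.
  by move=> q Wq; exact: (rowspace_projection (fA1 q Wq)).1.
have sS2 : smooth_matrix W S2.
  apply: smooth_matrixB => //; apply: smooth_matrixB => //.
    exact: smooth_matrix_cst.
  exact: smooth_matrix_le sSH.
have local_frame_of S D' : smooth_matrix W S ->
    (forall q, W q -> (S q)^T = S q /\ S q *m S q = S q) ->
    (forall q, W q -> (S q *m E q :=: D' q)%MS) ->
    exists V l (B : M -> 'M[R]_(l, n)), [/\ open V, V p,
      orthonormal_frame gM V D' (fun q => B q *m E q) & (B p)^T *m B p = S p].
  move=> sS pS SD'.
  have [V [l [B [oV Vp VW sB BP]]]] := smooth_projection_frame oW Wp sS pS.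
  exists V, l, B; split=> //; last exact: (BP p Vp).2.
  split.
    apply/(smooth_frameP _ oV)/smooth_frame_mul => //.
    exact: smooth_frame_le VW sEW.
  move=> q Vq; have [BB BS] := BP q Vq; have Wq := VW q Vq.
  split.
    rewrite trmx_mul !mulmxA -(mulmxA (B q)) -(mulmxA (B q)).
    by rewrite (frE q (WU q Wq)).1 mulmx1.
  apply: eqmx_trans (SD' q Wq); apply: eqmxMr; rewrite -BS.
  exact/eqmx_sym/orthonormal_rows_proj.
rewrite (sum_second_fundamental_form Up sE); apply/rowP => l; rewrite [RHS]mxE.
(* The traces are compared one component l in T_(F p)N at a time. *)
have [b trb] := trace_quadratic (E p)
  (fun v a w w' => hessianP F rM rN p v a w w') (hessianC rM rN sF p) l.
have trH : \tr (b *m SH p) = 0.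
  have [V [j [B [oV Vp oB <-]]]] := local_frame_of SH (horizontal gM F)
    (smooth_matrix_le WU sSH)
    (fun q Wq => let: And4 a b _ _ := SHP q Wq.1 in conj a b)
    (fun q Wq => let: And4 _ _ c _ := SHP q Wq.1 in c).
  by rewrite -trb (horizontal_trace rM rN rF mc oV Vp oB) mxE.
have tr2 : \tr (b *m S2 p) = 0.
  have [V [j [B [oV Vp oB <-]]]] := local_frame_of S2 (ker_complement gM F D) sS2
    (fun q Wq => let: And3 a b _ := S2P q Wq in conj a b)
    (fun q Wq => let: And3 _ _ c := S2P q Wq in c).
  rewrite -trb -(sum_second_fundamental_form Vp oB.1).
  by rewrite (tr0 p V j _ (conj oV Vp) oB) mxE.
(* The trace over D can be computed from a family X_i or from A X_i, and the
   second form changes sign from X_i to A X_i. *)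
have tr1 : \tr (b *m S1 p) = 0.
  have [S1T S1S1 S1A _] := S1P p Wp.
  have S1EA : (S1 p *m E p *m A p :=: S1 p *m E p)%MS.
    apply: eqmx_trans (eqmxMr _ (S1D p Wp)) _.
    by apply: eqmx_trans (DA p) _; exact: eqmx_sym (S1D p Wp).
  have [rho rhoE rhoS] := isometry_projection (gMT p) (frE p Up).1 (isoA p) S1T S1S1 S1EA.
  pose B v := hessian gM gN F p v v.
  have e1 : \tr (b *m S1 p) = (\sum_i B (row i (S1 p *m E p))) 0 l.
    by rewrite trb S1T S1S1.
  have e2 : \tr (b *m S1 p) = (\sum_i B (row i (S1 p *m rho *m E p))) 0 l.
    by rewrite trb rhoS.
  have : \tr (b *m S1 p) = - \tr (b *m S1 p).
    rewrite {1}e2 e1 !summxE -sumrN; apply: eq_bigr => i _.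
    rewrite -(mulmxA _ rho) rhoE mulmxA row_mul.
    have /submxP[c xE] : (row i (S1 p *m E p) <= E1 p)%MS.
      have [_ ->] := frE1 p W0p; rewrite -(S1D p Wp); exact: row_sub.
    (* Vectors of D at p extend to sections of D with constant components in E1. *)
    pose X q := c *m E1 q.
    have sX : smooth_field W X.
      exact: (smooth_frame_mul oW (smooth_matrix_cst W c) sE1f).
    have XD q : W q -> (X q <= D q)%MS.
      by move=> Wq; have [_ <-] := frE1 q Wq.2; exact: submxMl.
    rewrite xE -/(X p) /B.
    by rewrite (hessian_complex rM rN sF sA pA A2 iD Dker DA oW Wp sX XD) mxE.
  by move=> /eqP; rewrite -addr_eq0 -mulr2n mulrn_eq0 => /eqP.
rewrite -[E p]mul1mx trb trmx1 mulmx1.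
have -> : 1%:M = SH p + S1 p + S2 p.
  have split1 (a c : 'M[R]_n) : 1%:M = a + c + (1%:M - a - c).
    by apply/matrixP => i j; rewrite !mxE; ring.
  exact: split1.
have trD (x y z : 'M[R]_n) :
    \tr (b *m (x + y + z)) = \tr (b *m x) + \tr (b *m y) + \tr (b *m z).
  by rewrite !mulmxDr !linearD.
by rewrite trD trH tr1 tr2 !addr0.
Qed.

End Harmonicity.

Theorem theorem3p10 (R : realType) (n m : nat)
    (M : manifold R n) (N : manifold R m)
    (gM I J K : M -> 'M[R]_n) (gN : N -> 'M[R]_m) (F : M -> N)
    (DI DJ DK : M -> 'M[R]_n)
    (hM : hyperkahler gM I J K)
    (hN : riemannian_metric gN)
    (hF : almost_h_semi_slant gM gN F I J K DI DJ DK)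
    (hH : mean_curvature_zero gM gN F) :
  (integrable_distribution DI /\
     trace_zero_on gM gN F (ker_complement gM F DI) ->
     harmonic_map gM gN F) /\
  (integrable_distribution DJ /\
     trace_zero_on gM gN F (ker_complement gM F DJ) ->
     harmonic_map gM gN F) /\
  (integrable_distribution DK /\
     trace_zero_on gM gN F (ker_complement gM F DK) ->
     harmonic_map gM gN F).
Proof.
have [rM complex _ _ _] := hM; have [rF slI slJ slK] := hF.
have harm A D : A = I \/ A = J \/ A = K -> semi_slant_distribution gM F A D ->
    integrable_distribution D /\ trace_zero_on gM gN F (ker_complement gM F D) ->
    harmonic_map gM gN F.
  move=> /complex[sA pA A2 isoA] [dD Dker DA _] [iD tr0].
  exact: (harmonic_from_complex_structure rM hN rF hH sA pA A2 isoA dD Dker DA iD tr0).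
split; [|split].
- by apply: harm slI; left.
- by apply: harm slJ; right; left.
- by apply: harm slK; right; right.
Qed.
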